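(* Let $\big(\mathbf X(\cdot,t),\mu(\cdot,t)\big)\in \mathbb X_p\times\mathbb K_p$, $t\ge 0$, with $\mathbf X(\rho,0)=\mathbf X_0(L_0\rho)$, be a solution of the variational problem $$\big(\partial_t\mathbf X,\varphi\,\mathbf n\big)_{\Gamma(t)}+\big(\partial_s\mu,\partial_s\varphi\big)_{\Gamma(t)}=0\quad\forall\varphi\in\mathbb K_p,\qquad \big(\mu,\mathbf n\cdot\boldsymbol\omega\big)_{\Gamma(t)}-\big(G(\theta)\partial_s\mathbf X,\partial_s\boldsymbol\omega\big)_{\Gamma(t)}=0\quad\forall\boldsymbol\omega\in\mathbb X_p .$$ Then the area/mass $A(t)=\int_0^{L(t)}y\,\partial_s x\,ds$ is conserved and the total interfacial energy $W_c(t)=\int_0^{L(t)}\gamma(\theta)\,ds$ is dissipative, i.e. $$A(t)\equiv A(0)=\int_0^{L_0}y_0(s)x_0'(s)\,ds,\qquad W_c(t)\le W_c(t_1)\le W_c(0)=\int_{\Gamma(0)}\gamma(\theta)\,ds,\qquad t\ge t_1\ge 0.$$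
   Context: The surface energy $\gamma\in C^1([-\pi,\pi])$ is positive and periodic: $\gamma(-\pi)=\gamma(\pi)$, $\gamma'(-\pi)=\gamma'(\pi)$. The surface energy matrix is $G(\theta)=\begin{pmatrix}\gamma(\theta)&-\gamma'(\theta)\\ \gamma'(\theta)&\gamma(\theta)\end{pmatrix}$. $\mathbb I=[0,1]$, $\mathbb K_p=H^1_p(\mathbb I)=\{u\in H^1(\mathbb I): u(0)=u(1)\}$, $\mathbb X_p=\mathbb K_p\times\mathbb K_p$. The closed curve $\Gamma(t)$ is parametrized by $\mathbf X(\rho,t)=(x(\rho,t),y(\rho,t))^T$, $\rho\in\mathbb I$, with arc length $s(\rho,t)=\int_0^\rho|\partial_q\mathbf X|\,dq$ and length $L(t)$, so $\partial_s=|\partial_\rho\mathbf X|^{-1}\partial_\rho$ and $ds=|\partial_\rho\mathbf X|\,d\rho$. The unit tangent is $\partial_s\mathbf X=(\cos\theta,\sin\theta)^T$, which defines the angle $\theta=\theta(\rho,t)$ (modulo $2\pi$, taken in $[-\pi,\pi]$), and the outward unit normal is $\mathbf n=(-\sin\theta,\cos\theta)^T=(-\partial_s y,\partial_s x)^T$. The inner product is $(u,v)_{\Gamma(t)}=\int_{\mathbb I}u\cdot v\,|\partial_\rho\mathbf X|\,d\rho$ for scalar- or vector-valued $u,v$; the time derivative $\partial_t$ is taken at fixed $\rho$. The initial curve is given by its arc length parametrization $\mathbf X_0(s)=(x_0(s),y_0(s))^T$, $0\le s\le L_0$, where $L_0$ is its length. The solution is understood to be sufficiently regular in $(\rho,t)$,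 with $|\partial_\rho\mathbf X|>0$, that all the derivatives above make sense, $\partial_t\mathbf X(\cdot,t)\in\mathbb X_p$, and one may differentiate under the integral sign in $t$. *)

(* Defs.v *)
From HB Require Import structures.
From mathcomp Require Import all_boot all_order all_algebra.
From mathcomp Require Import all_classical all_reals all_analysis.

Set Implicit Arguments.
Unset Strict Implicit.
Unset Printing Implicit Defensive.

Import Order.TTheory GRing.Theory Num.Theory.
Import numFieldNormedType.Exports.

Local Open Scope classical_set_scope.
Local Open Scope ring_scope.

(* One-sided at the points of A that are end points of A. *)
Definition has_derivative_in (R : realType) (A : set R) (f : R -> R) (x l : R)
    : Prop :=
  (fun z => (f z - f x) / (z - x)) @ within A x^' --> l.

(* Vectors of the plane. The norm of the library on matrices is the max-norm,
   hence [enorm]. *)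

Definition vec2 (R : realType) (a b : R) : 'cV[R]_2 :=
  \col_(i < 2) (if i == 0 then a else b).

Definition dot (R : realType) (u v : 'cV[R]_2) : R := \sum_(i < 2) u i 0 * v i 0.

Definition enorm (R : realType) (u : 'cV[R]_2) : R := Num.sqrt (dot u u).

Definition square_integrable (R : realType) (D : set R) (f : R -> R) : Prop :=
  measurable_fun D f /\
  (@lebesgue_measure R).-integrable D (fun x => (f x ^+ 2)%:E).

Definition test_function (R : realType) (a b : R) (psi : R -> R) : Prop :=
  [/\ forall x, derivable psi x 1,
      continuous (derive1 psi) &
      exists c d, [/\ a < c, d < b & forall x, psi x != 0 -> c <= x <= d]].

Definition weak_derivative (R : realType) (a b : R) (u du : R -> R) : Prop :=
  forall psi, test_function a b psi ->
    \int[@lebesgue_measure R]_(x in `[a, b]) (u x * derive1 psi x) =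
    - \int[@lebesgue_measure R]_(x in `[a, b]) (du x * psi x).

(* [H1 a b u du]: u is in H^1(a, b), with weak derivative du (determined up to
   a null set), and u is the continuous representative of its class, so that
   its values at the end points are meaningful. *)
Definition H1 (R : realType) (a b : R) (u du : R -> R) : Prop :=
  [/\ {within `[a, b], continuous u},
      square_integrable `[a, b] u,
      square_integrable `[a, b] du &
      weak_derivative a b u du].

(* The periodic spaces K_p and X_p = K_p x K_p, on [0, 1]. *)
Definition H1p (R : realType) (u du : R -> R) : Prop :=
  H1 0 1 u du /\ u 0 = u 1.

Definition H1pv (R : realType) (u du : R -> 'cV[R]_2) : Prop :=
  forall i : 'I_2, H1p (fun r => u r i 0) (fun r => du r i 0).

Definition surface_energy (R : realType) (gamma dgamma : R -> R) : Prop :=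
  [/\ forall th, - pi <= th <= pi -> 0 < gamma th,
      forall th, - pi <= th <= pi ->
        has_derivative_in `[- pi, pi] gamma th (dgamma th),
      {within `[- pi, pi], continuous dgamma},
      gamma (- pi) = gamma pi &
      dgamma (- pi) = dgamma pi].

Definition surface_energy_matrix (R : realType) (gamma dgamma : R -> R) (th : R)
    : 'M[R]_2 :=
  \matrix_(i < 2, j < 2)
    if i == j then gamma th else if i == 0 then - dgamma th else dgamma th.

(* Geometry of a curve X : [0, 1] -> R^2. As everything depends on X only
   through its derivative dX, the latter is the parameter. *)

Definition ds (R : realType) (dX : R -> 'cV[R]_2) (df : R -> R) (r : R) : R :=
  (enorm (dX r))^-1 * df r.

Definition dsv (R : realType) (dX dv : R -> 'cV[R]_2) (r : R) : 'cV[R]_2 :=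
  (enorm (dX r))^-1 *: dv r.

Definition tangent (R : realType) (dX : R -> 'cV[R]_2) : R -> 'cV[R]_2 :=
  dsv dX dX.

Definition normal (R : realType) (dX : R -> 'cV[R]_2) (r : R) : 'cV[R]_2 :=
  vec2 (- tangent dX r 1 0) (tangent dX r 0 0).

Definition tangent_angle (R : realType) (dX : R -> 'cV[R]_2) (theta : R -> R)
    : Prop :=
  forall r, 0 <= r <= 1 -> dX r != 0 ->
    - pi <= theta r <= pi /\ tangent dX r = vec2 (cos (theta r)) (sin (theta r)).

(* The integral of f over the curve with respect to arc length; by the change
   of variable ds = |dX| dr it is also the integral of f ds from 0 to the
   length of the curve. *)
Definition line_integral (R : realType) (dX : R -> 'cV[R]_2) (f : R -> R) : R :=
  \int[@lebesgue_measure R]_(r in `[0, 1]) (f r * enorm (dX r)).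

Definition inner (R : realType) (dX : R -> 'cV[R]_2) (u v : R -> R) : R :=
  line_integral dX (fun r => u r * v r).

Definition innerv (R : realType) (dX u v : R -> 'cV[R]_2) : R :=
  line_integral dX (fun r => dot (u r) (v r)).

Definition area (R : realType) (X dX : R -> 'cV[R]_2) : R :=
  line_integral dX (fun r => X r 1 0 * tangent dX r 0 0).

Definition energy (R : realType) (gamma : R -> R) (dX : R -> 'cV[R]_2)
    (theta : R -> R) : R :=
  line_integral dX (fun r => gamma (theta r)).

(* Evolving curves: the arguments of X are the parameter r in [0, 1] and the
   time t >= 0; dX, Xt and dXt are the derivatives of X with respect to r, to
   t, and to both. The space derivatives are only required to exist in the
   sense of H^1; the two domination fields are what differentiation under the
   integral sign needs. If X, dX, Xt and dXt exist classically and are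
   continuous on [0, 1] x [0, +oo[, X is closed and dX does not
   vanish, then all the fields hold. *)
Record regular_evolution (R : realType) (X dX Xt dXt : R -> R -> 'cV[R]_2)
    : Prop := RegularEvolution {
  evolution_Xp : forall t, 0 <= t -> H1pv (X^~ t) (dX^~ t) ;
  evolution_dt : forall r t, 0 <= r <= 1 -> 0 <= t -> forall i : 'I_2,
    has_derivative_in `[0, +oo[ (fun t' => X r t' i 0) t (Xt r t i 0) ;
  evolution_dt_Xp : forall t, 0 <= t -> H1pv (Xt^~ t) (dXt^~ t) ;
  evolution_dt_dX : {ae @lebesgue_measure R, forall r, 0 <= r <= 1 ->
    forall t, 0 <= t -> forall i : 'I_2,
    has_derivative_in `[0, +oo[ (fun t' => dX r t' i 0) t (dXt r t i 0)} ;
  evolution_dominated_Xt : forall T, 0 <= T -> exists M, forall r t,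
    0 <= r <= 1 -> 0 <= t <= T -> enorm (Xt r t) <= M ;
  evolution_dominated_dXt : forall T, 0 <= T -> exists2 h : R -> R,
    (@lebesgue_measure R).-integrable `[0, 1] (EFin \o h) &
    {ae @lebesgue_measure R, forall r, 0 <= r <= 1 ->
      forall t, 0 <= t <= T -> enorm (dXt r t) <= h r} ;
  evolution_nondegenerate : forall T, 0 <= T -> exists2 c : R, 0 < c &
    {ae @lebesgue_measure R, forall r, 0 <= r <= 1 ->
      forall t, 0 <= t <= T -> c <= enorm (dX r t)}
}.

Record variational_solution (R : realType) (gamma dgamma : R -> R)
    (dX Xt : R -> R -> 'cV[R]_2) (theta mu dmu : R -> R -> R)
    : Prop := VariationalSolution {
  solution_Kp : forall t, 0 <= t -> H1p (mu^~ t) (dmu^~ t) ;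
  solution_motion : forall t, 0 <= t -> forall phi dphi, H1p phi dphi ->
    innerv (dX^~ t) (Xt^~ t) (fun r => phi r *: normal (dX^~ t) r) +
    inner (dX^~ t) (ds (dX^~ t) (dmu^~ t)) (ds (dX^~ t) dphi) = 0 ;
  solution_potential : forall t, 0 <= t -> forall omega domega,
    H1pv omega domega ->
    inner (dX^~ t) (mu^~ t) (fun r => dot (normal (dX^~ t) r) (omega r)) -
    innerv (dX^~ t)
      (fun r => surface_energy_matrix gamma dgamma (theta r t)
                  *m tangent (dX^~ t) r)
      (dsv (dX^~ t) domega) = 0
}.

(* X0 : [0, L0] -> R^2 is parametrized by arc length, so L0 is its length. *)
Definition arclength_curve (R : realType) (L0 : R) (X0 dX0 : R -> 'cV[R]_2)
    : Prop :=
  [/\ 0 < L0,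
      forall i : 'I_2, H1 0 L0 (fun s => X0 s i 0) (fun s => dX0 s i 0) &
      {ae @lebesgue_measure R, forall s, 0 <= s <= L0 -> enorm (dX0 s) = 1}].

(* Main.v *)
Require Import Defs.
From HB Require Import structures.
From mathcomp Require Import all_boot all_order all_algebra.
From mathcomp Require Import all_classical all_reals all_analysis.
From mathcomp Require Import measurable_realfun ring lra.
Import Order.TTheory GRing.Theory Num.Theory.
Import numFieldNormedType.Exports.
Local Open Scope classical_set_scope.
Local Open Scope ring_scope.

Set Implicit Arguments.
Unset Strict Implicit.
Unset Printing Implicit Defensive.


(** Both conservation laws come from testing the variational problem with the
    right functions, as soon as the area and the energy may be differentiated
    in time.

    Since [|X'| (tangent) = X'], the area is the integral of [y x'] over
    [[0, 1]], with rate the integral of [y_t x' + y x_t']. An integration by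
    parts, whose boundary terms cancel by periodicity, turns this into the
    integral of [y_t x' - x_t y'], that is into the flux [(X_t, n)] of the
    velocity through the curve ([area_rate], [area_increment]). The first
    equation with the test function 1 says that this flux vanishes.

    The energy density [gamma (theta) |X'|] is a positively homogeneous
    function of the vector [X'], whose gradient is [G (theta) (tangent)]
    ([energy_density_derivative]). So the rate of the energy is the term
    [(G (theta) d_s X, d_s X_t)] of the second equation with [omega = X_t]
    ([energy_increment]); that equation makes it [(mu, n . X_t)], and the first
    one with [phi = mu] makes this [- (d_s mu, d_s mu)], which is nonpositive.

    Three analytic points support these computations. The derivative of [X'] in
    time exists for almost every parameter only, and is one-sided at time 0: the
    integrals are restricted to a set of full measure on which all the
    hypotheses hold at once ([evolution_regular_set]), and the increments of
    area and energy are obtained from the mean value theorem, which involves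
    derivatives at interior times only ([integral_increment]). The functions of
    H^1 are known through test functions: they are shown to be primitives of
    their weak derivatives ([primitive_on_H1]). Finally, the integral of
    [u dv], for [u] continuous and [v] a primitive, is a limit of Stieltjes sums
    ([riemann_stieltjes_sum]). Summation by parts in these sums yields the
    integration by parts, and their invariance under a change of parameter
    yields the expression of the initial area in terms of the arc length. *)


(** * Real functions integrable for the Lebesgue measure *)

(** The lemmas of this section fix the Borel structure on the line, which the
    real type alone does not determine. *)
Notation Rintegrable D f := ((@lebesgue_measure _).-integrable D (EFin \o f)).

Section Rintegrable.
Context {R : realType}.
Notation mu := (@lebesgue_measure R).
Implicit Types (D : set R) (f g h : R -> R).

Lemma Rintegrable_measurable D f : Rintegrable D f -> measurable_fun D f.
Proof. by move=> /integrableP[/measurable_EFinP]. Qed.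

Lemma RintegrableS D E f : measurable E -> measurable D -> D `<=` E ->
  Rintegrable E f -> Rintegrable D f.
Proof. exact: (@integrableS _ (measurableTypeR R)). Qed.

Lemma RintegrableD D f g : measurable D -> Rintegrable D f -> Rintegrable D g ->
  Rintegrable D (fun x => f x + g x).
Proof.
move=> mD.
exact: (@integrableD _ (measurableTypeR R) _ mu _ mD (EFin \o f) (EFin \o g)).
Qed.

Lemma RintegrableB D f g : measurable D -> Rintegrable D f -> Rintegrable D g ->
  Rintegrable D (fun x => f x - g x).
Proof.
move=> mD.
exact: (@integrableB _ (measurableTypeR R) _ mu _ mD (EFin \o f) (EFin \o g)).
Qed.

Lemma RintegrableZ D k f : measurable D -> Rintegrable D f ->
  Rintegrable D (fun x => k * f x).
Proof.
by move=> mD; exact: (@integrableZl _ (measurableTypeR R) _ mu _ mD k (EFin \o f)).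
Qed.

Lemma Rintegrable_normr D f : measurable D -> Rintegrable D f ->
  Rintegrable D (fun x => `|f x|).
Proof. by move=> mD /integrable_abse. Qed.

Lemma le_Rintegrable D f g : measurable D -> measurable_fun D f ->
  (forall x, D x -> `|f x| <= g x) -> Rintegrable D g -> Rintegrable D f.
Proof.
move=> mD mf fg; apply: (@le_integrable _ (measurableTypeR R)) => //.
  exact/measurable_EFinP.
by move=> x Dx; rewrite /= lee_fin (le_trans (fg _ Dx))// ler_norm.
Qed.

Lemma RintegrableM D h f (M : R) : measurable D -> measurable_fun D h ->
  (forall x, D x -> `|h x| <= M) -> Rintegrable D f ->
  Rintegrable D (fun x => h x * f x).
Proof.
move=> mD mh hM fi; apply: (@le_Rintegrable _ _ (fun x => M * `|f x|)) => //.
- by apply: measurable_funM => //; exact: Rintegrable_measurable.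
- by move=> x Dx; rewrite normrM ler_wpM2r// hM.
- exact/RintegrableZ/Rintegrable_normr.
Qed.

Lemma continuous_Rintegrable f (a b : R) : {within `[a, b], continuous f} ->
  Rintegrable `[a, b] f.
Proof.
by apply: continuous_compact_integrable => //; exact: segment_compact.
Qed.

Lemma square_integrable_Rintegrable (a b : R) f : square_integrable `[a, b] f ->
  Rintegrable `[a, b] f.
Proof.
move=> [mf f2]; apply: (@le_Rintegrable _ _ (fun x => 1 + f x ^+ 2)) => //.
  move=> x _; rewrite ler_norml; apply/andP; split; nra.
apply: RintegrableD => //; apply: continuous_Rintegrable.
by move=> x; exact: cvg_cst.
Qed.

Lemma continuous_itv_bounded f (a b : R) : {within `[a, b], continuous f} ->
  exists2 M : R, 0 <= M & forall x, a <= x <= b -> `|f x| <= M.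
Proof.
move=> /continuous_compact/(_ (segment_compact (a := a) (b := b))).
move=> /compact_bounded[M [_ hM]]; exists (`|M| + 1); first by rewrite addr_ge0.
move=> x xab; apply: (hM (`|M| + 1)); last by exists x.
by rewrite ltr_pwDr// ler_norm.
Qed.

Lemma RintegrableMl (a b : R) h f : {within `[a, b], continuous h} ->
  Rintegrable `[a, b] f -> Rintegrable `[a, b] (fun x => h x * f x).
Proof.
move=> ch; have [M _ hM] := continuous_itv_bounded ch.
by apply: (@RintegrableM _ _ _ M) => //; exact: subspace_continuous_measurable_fun.
Qed.

Lemma ler_norm_Rintegral D f g : measurable D -> Rintegrable D f -> Rintegrable D g ->
  (forall x, D x -> `|f x| <= g x) ->
  `|\int[mu]_(x in D) f x| <= \int[mu]_(x in D) g x.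
Proof.
move=> mD fi gi fg.
apply: (le_trans (@le_normr_Rintegral _ (measurableTypeR R) _ mu _ _ mD fi)).
by apply: (@le_Rintegral _ (measurableTypeR R)) => //; exact: Rintegrable_normr.
Qed.

Lemma RintegralD_lebesgue D f g : measurable D -> Rintegrable D f -> Rintegrable D g ->
  \int[mu]_(x in D) (f x + g x) = \int[mu]_(x in D) f x + \int[mu]_(x in D) g x.
Proof. exact: (@RintegralD _ (measurableTypeR R)). Qed.

Lemma RintegralB_lebesgue D f g : measurable D -> Rintegrable D f -> Rintegrable D g ->
  \int[mu]_(x in D) (f x - g x) = \int[mu]_(x in D) f x - \int[mu]_(x in D) g x.
Proof. exact: (@RintegralB _ (measurableTypeR R)). Qed.

Lemma RintegralZl_lebesgue D f k : measurable D -> Rintegrable D f ->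
  \int[mu]_(x in D) (k * f x) = k * \int[mu]_(x in D) f x.
Proof. exact: (@RintegralZl _ (measurableTypeR R)). Qed.

Lemma Rintegral_setD_negligible D N f : measurable D -> measurable N ->
  mu N = 0%E -> Rintegrable D f ->
  \int[mu]_(x in D `\` N) f x = \int[mu]_(x in D) f x.
Proof.
move=> mD mN N0 fi.
by rewrite [RHS]/Rintegral (@negligible_integral _ (measurableTypeR R) _ mu D N).
Qed.

End Rintegrable.

(** * Derivatives relative to a set *)

(** Clearing the denominator removes the exception at the point itself. *)
Lemma has_derivative_inP (R : realType) (A : set R) (f : R -> R) (x l : R) :
  has_derivative_in A f x l <->
  forall e : R, 0 < e -> exists2 d : R, 0 < d & forall z, A z -> `|z - x| < d ->
    `|f z - f x - l * (z - x)| <= e * `|z - x|.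
Proof.
split=> [/cvgrPdist_le H e e0|H].
  have [d /= d0 Hd] := H e e0.
  exists d => // z Az zd.
  have [->|zx] := eqVneq z x; first by rewrite !subrr mulr0 subrr normr0 mulr0.
  have /= := Hd z; rewrite distrC => /(_ zd zx Az) Hz.
  have zx0 : z - x != 0 by rewrite subr_eq0.
  have -> : f z - f x - l * (z - x) = - (l - (f z - f x) / (z - x)) * (z - x).
    by field.
  by rewrite normrM normrN ler_wpM2r.
apply/cvgrPdist_le => e e0; have [d d0 Hd] := H e e0.
exists d => //= z /=; rewrite distrC => zd zx Az.
have zx0 : z - x != 0 by rewrite subr_eq0.
have := Hd z Az zd.
have -> : f z - f x - l * (z - x) = - (l - (f z - f x) / (z - x)) * (z - x).
  by field.
by rewrite normrM normrN ler_pM2r // normr_gt0.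
Qed.

Lemma is_deriveP (R : realType) (f : R -> R) (x l : R) :
  is_derive x 1 f l <-> has_derivative_in setT f x l.
Proof.
have E : has_derivative_in setT f x l <->
    h^-1 *: (f (h + x) - f x) @[h --> 0^'] --> l.
  split=> [/cvgrPdist_le H|/cvgrPdist_le H]; apply/cvgrPdist_le => e e0.
    have [d /= d0 Hd] := H e e0; exists d => //= h /=.
    rewrite distrC subr0 => hd h0.
    have /= := Hd (h + x); rewrite opprD addrCA subrr addr0 normrN => /(_ hd).
    rewrite addrK -subr_eq0 addrK => /(_ h0 I).
    by rewrite /GRing.scale /= mulrC.
  have [d /= d0 Hd] := H e e0; exists d => //= z /=.
  rewrite distrC => hd h0 _.
  have /= := Hd (z - x); rewrite distrC subr0 => /(_ hd).
  by rewrite subr_eq0 subrK => /(_ h0); rewrite /GRing.scale /= mulrC.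
split=> [[df dfl]|/E H].
  apply/E; move: df dfl; rewrite /derivable /derive.
  under eq_fun do rewrite /= scaler1.
  by move=> /cvg_ex[l' l'f] <-; rewrite (cvg_lim _ l'f).
split; rewrite /derivable /derive; under eq_fun do rewrite /= scaler1.
  by apply/cvg_ex; exists l.
exact: cvg_lim.
Qed.

Lemma has_derivative_in_is_derive (R : realType) (A : set R) (f : R -> R)
    (x l : R) :
  nbhs x A -> has_derivative_in A f x l -> is_derive x 1 f l.
Proof.
move=> [d' /= d'0 xA] /has_derivative_inP H.
apply/is_deriveP/has_derivative_inP => e e0.
have [d d0 Hd] := H e e0; exists (Num.min d d'); first by rewrite lt_min d0 d'0.
move=> z _; rewrite lt_min => /andP[zd zd']; apply: Hd => //.
by apply: xA => /=; rewrite distrC.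
Qed.

(** Past the set on which a function is known, the affine function with the
    right slope continues it. This turns a one-sided derivative into a
    derivative, to which the calculus of derivatives applies. *)
Definition affine_continuation (R : realType) (A : set R) (f : R -> R) (x l : R)
    : R -> R :=
  fun z => if `[< A z >] then f z else f x + l * (z - x).

Lemma affine_continuationE (R : realType) (A : set R) (f : R -> R) (x l z : R) :
  A z -> affine_continuation A f x l z = f z.
Proof. by move=> Az; rewrite /affine_continuation asboolT. Qed.

Lemma is_derive_affine_continuation (R : realType) (A : set R) (f : R -> R)
    (x l : R) :
  A x -> has_derivative_in A f x l ->
  is_derive x 1 (affine_continuation A f x l) l.
Proof.
move=> Ax /has_derivative_inP H.
apply/is_deriveP/has_derivative_inP => e e0.
have [d d0 Hd] := H e e0; exists d => // z _ zd.
rewrite (affine_continuationE _ _ _ Ax) /affine_continuation.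
case: asboolP => [Az|_]; first exact: Hd.
rewrite [X in `|X|](_ : _ = 0); last by ring.
by rewrite normr0 mulr_ge0// ltW.
Qed.

Lemma is_derive_has_derivative_in (R : realType) (A : set R) (f g : R -> R)
    (x l : R) :
  A x -> is_derive x 1 g l -> (\forall z \near x, A z -> f z = g z) ->
  has_derivative_in A f x l.
Proof.
move=> Ax /is_deriveP/has_derivative_inP H fg.
have fgx : f x = g x by exact: (nbhs_singleton fg).
apply/has_derivative_inP => e e0; have [d d0 Hd] := H e e0.
have [d' /= d'0 Hd'] := fg.
exists (Num.min d d'); first by rewrite lt_min d0 d'0.
move=> z Az; rewrite lt_min => /andP[zd zd'].
have -> : f z = g z by apply: Hd' => //=; rewrite distrC.
by rewrite fgx; exact: Hd.
Qed.

Lemma has_derivative_in_continuous (R : realType) (A B : set R) (f df : R -> R) :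
  B `<=` A -> (forall x, B x -> has_derivative_in A f x (df x)) ->
  {within B, continuous f}.
Proof.
move=> BA H; apply/subspace_continuousP => x Bx.
apply/cvgrPdist_le => e e0.
have /has_derivative_inP /(_ _ ltr01)[d d0 Hd] := H x Bx.
have c0 : 0 < 1 + `|df x| by rewrite ltr_wpDr.
exists (Num.min d (e / (1 + `|df x|))).
  by rewrite /= lt_min d0 divr_gt0.
move=> z /=; rewrite distrC lt_min => /andP[zd]; rewrite ltr_pdivlMr// => ze Bz.
rewrite distrC.
have := Hd z (BA _ Bz) zd; rewrite mul1r => h.
rewrite -(subrK (df x * (z - x)) (f z - f x)).
apply: (le_trans (ler_normD _ _)); rewrite normrM.
by apply: le_trans (ltW ze); rewrite [leRHS]mulrDr mulr1 (mulrC `|df x|) lerD2r.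
Qed.

(** * Differentiation under the integral sign *)

Lemma mean_value_bound (R : realType) (A : set R) (f df : R -> R) (a b k : R) :
  a <= b -> `[a, b] `<=` A ->
  (forall x : R, a <= x <= b -> has_derivative_in A f x (df x)) ->
  (forall x : R, a <= x <= b -> `|df x| <= k) ->
  `|f b - f a| <= k * (b - a).
Proof.
move=> ab abA fdf dfk.
have cf : {within `[a, b], continuous f}.
  by apply: has_derivative_in_continuous abA _ => x; rewrite /= in_itv; exact: fdf.
have dfoo x : x \in `]a, b[ -> is_derive x 1 f (df x).
  move=> xab; apply: (@has_derivative_in_is_derive _ A).
    apply: filterS abA _; have := near_in_itvoo xab.
    by apply: filterS => y; exact: subset_itv_oo_cc.
  by apply: fdf; exact: (subset_itv_oo_cc xab).
have [c cab ->] := MVT_segment ab dfoo cf.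
by rewrite normrM (ger0_norm (_ : 0 <= b - a)) ?subr_ge0// ler_wpM2r ?subr_ge0 ?dfk.
Qed.

Section integral_derivative.
Context {R : realType}.
Notation mu := (@lebesgue_measure R).
Variables (B : set R) (T : R) (f df : R -> R -> R) (G : R -> R).
Hypothesis mB : measurable B.
Hypothesis fi : forall t : R, 0 <= t <= T -> Rintegrable B (f t).
Hypothesis fdf : forall r : R, B r -> forall t : R, 0 <= t <= T ->
  has_derivative_in `[0, +oo[ (f^~ r) t (df t r).
Hypothesis Gi : Rintegrable B G.
Hypothesis dfG : forall r : R, B r -> forall t : R, 0 <= t <= T -> `|df t r| <= G r.

Lemma integral_is_derive (t : R) : 0 < t < T ->
  is_derive t 1 (fun t : R => \int[mu]_(r in B) f t r) (\int[mu]_(r in B) df t r).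
Proof.
move=> t0T.
have d (s r : R) : `]0, T[%classic s -> B r -> is_derive s 1 (f^~ r) (df s r).
  rewrite /= in_itv /= => /andP[s0 sT] Br.
  apply: (@has_derivative_in_is_derive _ `[0, +oo[).
    have : s \in `]0, +oo[ by rewrite in_itv /= s0.
    move=> /near_in_itvoy; apply: filterS => y /=.
    by rewrite !in_itv /= !andbT => /ltW.
  by apply: fdf => //; rewrite !ltW.
have tI : `]0, T[%classic t by rewrite /= in_itv.
have fi' (s : R) : `]0, T[%classic s -> Rintegrable B (f s).
  by rewrite /= in_itv /= => /andP[s0 sT]; apply: fi; rewrite !ltW.
have dfE (s r : R) : `]0, T[%classic s -> B r -> partial1of2 f s r = df s r.
  by move=> sI Br; rewrite partial1of2E; have [] := d s r sI Br.
have der (s r : R) : `]0, T[%classic s -> B r -> derivable (f^~ r) s 1.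
  by move=> sI Br; have [] := d s r sI Br.
have Gi' : Rintegrable B (fun r => `|G r|).
  exact: Rintegrable_normr.
have ub (s r : R) : `]0, T[%classic s -> B r -> `|partial1of2 f s r| <= `|G r|.
  move=> sI Br; rewrite dfE//; apply: le_trans (ler_norm _).
  by apply: dfG => //; move: sI; rewrite /= in_itv /= => /andP[s0 sT]; rewrite !ltW.
have Gge0 r : 0 <= `|G r| by [].
split.
  exact: (@derivable_under_integral R _ (measurableTypeR R) mu _ _ mB
    _ _ _ tI fi' der _ Gge0 Gi' ub).
rewrite -derive1E.
rewrite (@differentiation_under_integral R _ (measurableTypeR R) mu _ _ mB
  _ _ _ tI fi' der _ Gge0 Gi' ub).
by apply: eq_Rintegral => r /set_mem Br; exact: dfE.
Qed.

(** The integral is even Lipschitz, with constant the integral of [G], as each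
    [f^~ r] is Lipschitz with constant [G r]. This covers the end points of the
    interval, where the derivative of the integral is not available. *)
Lemma integral_continuous :
  {within `[0, T], continuous (fun t : R => \int[mu]_(r in B) f t r)}.
Proof.
pose I := (fun t : R => \int[mu]_(r in B) f t r).
pose K := \int[mu]_(r in B) G r.
have lip (s t : R) : 0 <= s -> s <= t -> t <= T -> `|I t - I s| <= K * (t - s).
  move=> s0 st tT.
  have it : 0 <= t <= T by rewrite tT (le_trans s0).
  have is_ : 0 <= s <= T by rewrite s0 (le_trans st).
  rewrite /I -RintegralB_lebesgue//; [|exact: fi..].
  rewrite mulrC -RintegralZl_lebesgue//.
  apply: ler_norm_Rintegral => //.
  - by apply: RintegrableB => //; exact: fi.
  - exact: RintegrableZ.
  - move=> r Br; rewrite mulrC.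
    apply: (@mean_value_bound _ `[0, +oo[ (f^~ r) (df^~ r)) => //.
    + by move=> x /=; rewrite !in_itv /= andbT => /andP[+ _]; exact: le_trans.
    + by move=> x /andP[sx xt]; apply: fdf => //; rewrite (le_trans s0)// (le_trans xt).
    + by move=> x /andP[sx xt]; apply: dfG => //; rewrite (le_trans s0)// (le_trans xt).
have lip2 (s t : R) : 0 <= s <= T -> 0 <= t <= T -> `|I t - I s| <= `|K| * `|t - s|.
  move=> /andP[s0 sT] /andP[t0 tT]; have [st|/ltW ts] := leP s t.
    apply: (le_trans (lip _ _ s0 st tT)).
    by rewrite (ger0_norm (_ : 0 <= t - s)) ?subr_ge0// ler_wpM2r ?subr_ge0// ler_norm.
  rewrite distrC (distrC t); apply: (le_trans (lip _ _ t0 ts sT)).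
  by rewrite (ger0_norm (_ : 0 <= s - t)) ?subr_ge0// ler_wpM2r ?subr_ge0// ler_norm.
apply/subspace_continuousP => x; rewrite /= in_itv /= => xI.
apply/cvgrPdist_le => e e0.
have c0 : 0 < 1 + `|K| by rewrite ltr_wpDr.
exists (e / (1 + `|K|)); first by rewrite /= divr_gt0.
move=> z /=; rewrite ltr_pdivlMr// => ze; rewrite in_itv /= => zI.
apply: (le_trans (lip2 _ _ zI xI)); apply: le_trans (ltW ze).
by rewrite mulrC ler_wpM2l// lerDr.
Qed.

Lemma integral_increment (t1 : R) : 0 <= t1 -> t1 < T ->
  exists2 t : R, t1 < t < T &
    \int[mu]_(r in B) f T r - \int[mu]_(r in B) f t1 r =
    \int[mu]_(r in B) df t r * (T - t1).
Proof.
move=> t10 t1T.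
have [||t tI E] := @MVT _ (fun t : R => \int[mu]_(r in B) f t r)
    (fun t => \int[mu]_(r in B) df t r) t1 T t1T.
- move=> t; rewrite in_itv /= => /andP[t1t tT]; apply: integral_is_derive.
  by rewrite (le_lt_trans t10 t1t).
- apply: continuous_subspaceW integral_continuous => t /=; rewrite !in_itv /=.
  by move=> /andP[t1t ->]; rewrite (le_trans t10 t1t).
- by exists t => //; move: tI; rewrite in_itv.
Qed.

End integral_derivative.

(** * A continuously differentiable step *)

Section smooth_step.
Context {R : realType}.
Implicit Types x c d h : R.

Definition ramp x : R := Num.max x 0.

(** The second divided difference of the C^1 function [ramp ^+ 2]: it increases
    from 0 to 1 on [[0, 1]], and its derivative is the tent over [[0, 1]]. *)
Definition smooth_step x : R :=
  2 * (ramp x ^+ 2 - 2 * ramp (x - 1 / 2) ^+ 2 + ramp (x - 1) ^+ 2).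

Definition tent x : R := 4 * (ramp x - 2 * ramp (x - 1 / 2) + ramp (x - 1)).

Lemma rampP x : 0 <= x /\ ramp x = x \/ x <= 0 /\ ramp x = 0.
Proof.
rewrite /ramp; have [x0|/ltW x0] := leP x 0; [right|left]; by split.
Qed.

Lemma is_derive_comp_affine (f : R -> R) (l m k x : R) :
  is_derive (m * x + k) 1 f l -> is_derive x 1 (fun y => f (m * y + k)) (m * l).
Proof.
move=> df.
have dg : is_derive x 1 (m \*: (id : R -> R) + cst k) m.
  by apply: is_derive_eq; rewrite /GRing.scale /= mulr1 addr0.
by have := @is_derive1_comp _ f (m \*: id + cst k) x l m df dg; rewrite mulrC.
Qed.

Lemma is_derive_ramp_sqr x : is_derive x 1 (fun y => ramp y ^+ 2) (2 * ramp x).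
Proof.
apply/is_deriveP/has_derivative_inP => e e0; exists e => // z _ zx.
apply: (@le_trans _ _ (`|z - x| ^+ 2)); last first.
  by rewrite expr2 ler_wpM2r// ltW.
rewrite real_normK ?num_real//.
have zx2 := sqr_ge0 (z - x).
by case: (rampP z) => -[z0 ->]; case: (rampP x) => -[x0 ->];
   rewrite ler_norml; apply/andP; split; nra.
Qed.

Lemma is_derive_smooth_step x : is_derive x 1 smooth_step (tent x).
Proof.
have D k : is_derive x 1 (fun y => ramp (y - k) ^+ 2) (2 * ramp (x - k)).
  have := @is_derive_comp_affine (fun y => ramp y ^+ 2) _ 1 (- k) x
    (is_derive_ramp_sqr _).
  by under eq_fun do rewrite mul1r; rewrite !mul1r.
have D0 := is_derive_ramp_sqr x.
have D1 := D (1 / 2); have D2 := D 1.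
rewrite /smooth_step.
have -> : (fun x => 2 * (ramp x ^+ 2 - 2 * ramp (x - 1 / 2) ^+ 2 + ramp (x - 1) ^+ 2)) =
  2 \*: ((fun y => ramp y ^+ 2) - 2 \*: (fun y => ramp (y - 1 / 2) ^+ 2)
     + (fun y => ramp (y - 1) ^+ 2)) by [].
apply: is_derive_eq.
rewrite /tent /GRing.scale /=; ring.
Qed.

Lemma smooth_step_le0 x : x <= 0 -> smooth_step x = 0.
Proof.
move=> x0; rewrite /smooth_step.
case: (rampP x) => -[? ->]; case: (rampP (x - 1 / 2)) => -[? ->];
  case: (rampP (x - 1)) => -[? ->]; nra.
Qed.

Lemma smooth_step_ge1 x : 1 <= x -> smooth_step x = 1.
Proof.
move=> x0; rewrite /smooth_step.
case: (rampP x) => -[? ->]; case: (rampP (x - 1 / 2)) => -[? ->];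
  case: (rampP (x - 1)) => -[? ->]; nra.
Qed.

Lemma smooth_step_itv x : 0 <= smooth_step x <= 1.
Proof.
rewrite /smooth_step; case: (rampP x) => -[? ->]; case: (rampP (x - 1 / 2)) => -[? ->];
  case: (rampP (x - 1)) => -[? ->]; apply/andP; split; nra.
Qed.

Lemma tent_ge0 x : 0 <= tent x.
Proof.
rewrite /tent; case: (rampP x) => -[? ->]; case: (rampP (x - 1 / 2)) => -[? ->];
  case: (rampP (x - 1)) => -[? ->]; lra.
Qed.

Lemma tent_neq0 x : tent x != 0 -> 0 <= x <= 1.
Proof.
apply: contraNT; rewrite negb_and -!ltNge => /orP xH; apply/eqP; rewrite /tent.
case: (rampP x) => -[? ->]; case: (rampP (x - 1 / 2)) => -[? ->];
  case: (rampP (x - 1)) => -[? ->]; case: xH => ?; lra.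
Qed.

Lemma continuous_tent : continuous tent.
Proof.
have C k : continuous (fun x => ramp (x - k)).
  move=> x; apply: (@continuous_comp _ _ _ (fun x => x - k) ramp).
    by apply: continuousD; [exact: id|exact: cst_continuous].
  by apply: continuous_max; [exact: id|exact: cst_continuous].
have C0 : continuous ramp.
  by move=> x; apply: continuous_max; [exact: id|exact: cst_continuous].
move=> x; rewrite /tent; apply: cvgM; first exact: cvg_cst.
apply: cvgD; last exact: C.
apply: cvgB; first exact: C0.
by apply: cvgM; [exact: cvg_cst|exact: C].
Qed.

End smooth_step.

(** * Weakly differentiable functions are primitives *)

Section fundamental_theorem.
Context {R : realType}.
Notation mu := (@lebesgue_measure R).

Lemma Rintegral_is_derive (F f : R -> R) (a b : R) : a < b ->
  (forall x : R, is_derive x 1 F (f x)) -> continuous f ->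
  \int[mu]_(x in `[a, b]) f x = F b - F a.
Proof.
move=> ab dF cf.
have cF : continuous F.
  move=> x; apply/differentiable_continuous/derivable1_diffP.
  by have [] := dF x.
rewrite /Rintegral (@continuous_FTC2 _ f F)//.
- exact: continuous_subspaceT.
- split=> [x _||].
  + by have [] := dF x.
  + exact/cvg_at_right_filter/cF.
  + exact/cvg_at_left_filter/cF.
- by move=> x _; rewrite derive1E; have [_ ->] := dF x.
Qed.

(** The tent rescaled by [y |-> m y + q] has mass 1 on [[a, b]], so that the
    integral of its product with [u] is an average of [u] near [p]. *)
Lemma tent_average (u : R -> R) (a b m q p e : R) : a < b -> 0 < m ->
  {within `[a, b], continuous u} -> m * a + q <= 0 -> 1 <= m * b + q ->
  (forall x : R, a <= x <= b -> 0 <= m * x + q <= 1 -> `|u x - u p| <= e) ->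
  `|\int[mu]_(x in `[a, b]) (u x * (m * tent (m * x + q))) - u p| <= e.
Proof.
move=> ab m0 cu ma mb up.
pose k (x : R) := m * tent (m * x + q).
have ck : continuous k.
  move=> x; apply: cvgM; first exact: cvg_cst.
  apply: (@continuous_comp _ _ _ (fun x => m * x + q) tent).
    apply: cvgD; last exact: cvg_cst.
    by apply: cvgM; [exact: cvg_cst|exact: cvg_id].
  exact: continuous_tent.
have ki : Rintegrable `[a, b] k.
  by apply: continuous_Rintegrable; exact: continuous_subspaceT.
have k0 (x : R) : 0 <= k x by rewrite mulr_ge0 ?tent_ge0// ltW.
have k1 : \int[mu]_(x in `[a, b]) k x = 1.
  have dk (x : R) : is_derive x 1 (fun x => smooth_step (m * x + q)) (k x).
    by apply: is_derive_comp_affine; exact: is_derive_smooth_step.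
  have -> := @Rintegral_is_derive _ k a b ab dk ck.
  by rewrite smooth_step_ge1// smooth_step_le0// subr0.
have uki : Rintegrable `[a, b] (fun x => u x * k x) by exact: RintegrableMl.
rewrite -[X in _ - X]mulr1 -k1 -RintegralZl_lebesgue// -RintegralB_lebesgue//; last first.
  exact: RintegrableZ.
rewrite -[leRHS]mulr1 -k1 -RintegralZl_lebesgue//.
apply: ler_norm_Rintegral => //.
- by apply: RintegrableB => //; exact: RintegrableZ.
- exact: RintegrableZ.
- move=> x; rewrite /= in_itv /= => xab.
  rewrite -mulrBl normrM (ger0_norm (k0 x)).
  have [kx0|kx0] := eqVneq (k x) 0; first by rewrite kx0 !mulr0.
  rewrite ler_wpM2r// up//; apply: tent_neq0.
  by apply: contra_neq kx0; rewrite /k => ->; rewrite mulr0.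
Qed.

Lemma dominated_cvg_Rintegral (D : set R) (f_ : nat -> R -> R) (f g : R -> R) :
  measurable D -> (forall n, measurable_fun D (f_ n)) ->
  (forall x, D x -> f_ n x @[n --> \oo] --> f x) ->
  Rintegrable D g -> (forall n x, D x -> `|f_ n x| <= g x) ->
  \int[mu]_(x in D) f_ n x @[n --> \oo] --> \int[mu]_(x in D) f x.
Proof.
move=> mD mf ff gi fg.
have mflim : measurable_fun D f by exact: measurable_fun_cvg mf ff.
have [] := @dominated_convergence _ (measurableTypeR R) _ mu D mD
  (fun n x => (f_ n x)%:E) (EFin \o f) (EFin \o g).
- by move=> n; apply/measurable_EFinP; exact: mf.
- exact/measurable_EFinP.
- by apply: aeW => x Dx; apply: cvg_EFin; [exact: nearW|exact: ff].
- exact: gi.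
- by apply: aeW => x n Dx; rewrite lee_fin fg.
move=> fi _ H; apply: fine_cvg; rewrite fineK//.
exact: (@integrable_fin_num _ (measurableTypeR R)).
Qed.

(** The test function [psi n] rises from 0 to 1 just after [c] and falls back to
    0 just before [d]. When the two ramps shrink, [psi n] tends to the indicator
    function of [`]c, d[], so that the integral of [du * psi n] tends to that of
    [du] over [[c, d]], while the integral of [u * psi' n] is the difference of
    averages of [u] near [c] and near [d]. *)
Lemma weak_derivative_increment_oo (u du : R -> R) (a b c d : R) :
  a < c -> c < d -> d < b -> {within `[a, b], continuous u} ->
  Rintegrable `[a, b] du -> weak_derivative a b u du ->
  u d - u c = \int[mu]_(x in `[c, d]) du x.
Proof.
move=> ac cd db cu dui wd.
have ab : a < b by apply: lt_trans (lt_trans ac cd) db.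
have dc0 : 0 < d - c by rewrite subr_gt0.
pose m (n : nat) : R := n.+1%:R / (d - c).
have m0 n : 0 < m n by rewrite divr_gt0.
have mcd n : m n * (d - c) = n.+1%:R by rewrite /m divfK// gt_eqF.
have n1 n : 1 <= n.+1%:R :> R by rewrite ler1n.
pose k1 n (x : R) := m n * tent (m n * x + - (m n * c)).
pose k2 n (x : R) := m n * tent (m n * x + (1 - m n * d)).
pose psi n (x : R) :=
  smooth_step (m n * x + - (m n * c)) - smooth_step (m n * x + (1 - m n * d)).
have dpsi n (x : R) : is_derive x 1 (psi n) (k1 n x - k2 n x).
  have D1 : is_derive x 1 (fun x => smooth_step (m n * x + - (m n * c))) (k1 n x).
    by apply: is_derive_comp_affine; exact: is_derive_smooth_step.
  have D2 : is_derive x 1 (fun x => smooth_step (m n * x + (1 - m n * d))) (k2 n x).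
    by apply: is_derive_comp_affine; exact: is_derive_smooth_step.
  exact: is_deriveB.
have dpsiE n : derive1 (psi n) = (fun x => k1 n x - k2 n x).
  by apply/funext => x; rewrite derive1E; have [_ ->] := dpsi n x.
have ck q n : continuous (fun x : R => m n * tent (m n * x + q)).
  move=> x; apply: cvgM; first exact: cvg_cst.
  apply: (@continuous_comp _ _ _ (fun x => m n * x + q) tent).
    apply: cvgD; last exact: cvg_cst.
    by apply: cvgM; [exact: cvg_cst|exact: cvg_id].
  exact: continuous_tent.
have psi_le n x : x <= c -> psi n x = 0.
  move=> xc; rewrite /psi !smooth_step_le0 ?subrr//.
    have := mcd n; have := m0 n; have := n1 n; nra.
  have := m0 n; nra.
have psi_ge n x : d <= x -> psi n x = 0.
  move=> xc; rewrite /psi !smooth_step_ge1 ?subrr//.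
    have := m0 n; nra.
  have := mcd n; have := m0 n; have := n1 n; nra.
have psi_bound n x : `|psi n x| <= 1.
  rewrite /psi; move: (smooth_step_itv (m n * x + - (m n * c))) => /andP[].
  move: (smooth_step_itv (m n * x + (1 - m n * d))) => /andP[].
  move=> ? ? ? ?; rewrite ler_norml; apply/andP; split; lra.
have cpsi n : continuous (psi n).
  move=> x; apply/differentiable_continuous/derivable1_diffP.
  by have [] := dpsi n x.
have tpsi n : test_function a b (psi n).
  split.
  - by move=> x; have [] := dpsi n x.
  - by rewrite dpsiE => x; apply: cvgB; exact: ck.
  - exists c, d; split => // x; apply: contraNT; rewrite negb_and -!ltNge => /orP[xc|xd].
      by rewrite psi_le// ltW.
    by rewrite psi_ge// ltW.
have L n : \int[mu]_(x in `[a, b]) (u x * derive1 (psi n) x) =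
    \int[mu]_(x in `[a, b]) (u x * k1 n x) - \int[mu]_(x in `[a, b]) (u x * k2 n x).
  rewrite -RintegralB_lebesgue//.
  - by apply: eq_Rintegral => x _; rewrite dpsiE mulrBr.
  - apply: RintegrableMl => //; apply: continuous_Rintegrable.
    exact: continuous_subspaceT (@ck _ _).
  - apply: RintegrableMl => //; apply: continuous_Rintegrable.
    exact: continuous_subspaceT (@ck _ _).
(* both tents have width [1 / m n], which tends to 0 *)
have near_m (e : R) : 0 < e ->
    \forall n \near \oo, forall t, 0 <= m n * t <= 1 -> `|t| <= e.
  move=> e0; near=> n => t /andP[t0 t1].
  have {}t0 : 0 <= t by rewrite -(pmulr_rge0 _ (m0 n)).
  rewrite ger0_norm//.
  have : (d - c) / e < n%:R by near: n; exact: nbhs_infty_gtr.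
  rewrite ltr_pdivrMr// => H.
  have := mcd n; rewrite -natr1; have := m0 n => M0 M1.
  have : m n * t * (d - c) <= n%:R * e + e by nra.
  have -> : m n * t * (d - c) = (n%:R + 1) * t by rewrite -M1; ring.
  have n0 : 0 <= n%:R :> R by [].
  nra.
have L1 : \int[mu]_(x in `[a, b]) (u x * k1 n x) @[n --> \oo] --> u c.
  apply/cvgrPdist_le => e e0.
  have cc : {for c, continuous u}.
    by apply: (within_continuous_continuous ab cu); rewrite in_itv /= ac (lt_trans cd).
  move/cvgrPdist_le : cc => /(_ _ e0)[r /= r0 ur].
  have := near_m (r / 2); rewrite divr_gt0// => /(_ isT); apply: filterS => n nm.
  rewrite distrC; apply: tent_average => //.
  - have := m0 n; nra.
  - have := mcd n; have := m0 n; have := n1 n; nra.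
  - move=> x xab x01; rewrite distrC; apply: ur => /=; rewrite distrC.
    apply: (@le_lt_trans _ _ (r / 2)); last first.
      by rewrite ltr_pdivrMr// mulr_natr mulr2n ltrDl.
    by apply: nm; rewrite mulrBr.
have L2 : \int[mu]_(x in `[a, b]) (u x * k2 n x) @[n --> \oo] --> u d.
  apply/cvgrPdist_le => e e0.
  have cc : {for d, continuous u}.
    by apply: (within_continuous_continuous ab cu); rewrite in_itv /= db (lt_trans ac).
  move/cvgrPdist_le : cc => /(_ _ e0)[r /= r0 ur].
  have := near_m (r / 2); rewrite divr_gt0// => /(_ isT); apply: filterS => n nm.
  rewrite distrC; apply: tent_average => //.
  - have := mcd n; have := m0 n; have := n1 n; nra.
  - have := m0 n; nra.
  - move=> x xab x01; rewrite distrC; apply: ur => /=.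
    apply: (@le_lt_trans _ _ (r / 2)); last first.
      by rewrite ltr_pdivrMr// mulr_natr mulr2n ltrDl.
    by apply: nm; rewrite mulrBr; lra.
have R1 : \int[mu]_(x in `[a, b]) (du x * psi n x) @[n --> \oo] -->
    \int[mu]_(x in `[a, b]) ((du \_ `]c, d[) x).
  apply: (@dominated_cvg_Rintegral _ _ _ (fun x => `|du x|)) => //.
  - move=> n; apply: measurable_funM; first exact: Rintegrable_measurable.
    by apply: measurable_funTS; exact: continuous_measurable_fun.
  - move=> x _; rewrite patchE; case: ifPn => [|xcd].
      rewrite inE /= in_itv /= => /andP[cx xd].
      rewrite -[X in _ --> X]mulr1; apply: cvgM; first exact: cvg_cst.
      apply: cvg_near_cst.
      have e0 : 0 < Num.min (x - c) (d - x) / 2.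
        by rewrite divr_gt0// lt_min !subr_gt0 cx xd.
      have := near_m _ e0; apply: filterS => n nm.
      have M := m0 n.
      have lem t : Num.min (x - c) (d - x) <= t -> 1 <= m n * t.
        move=> ht; have t0 : 0 < t.
          by apply: lt_le_trans ht; rewrite lt_min !subr_gt0 cx xd.
        rewrite leNgt; apply/negP => t1.
        have := nm t; rewrite (ltW t1) (mulr_ge0 (ltW M) (ltW t0)) => /(_ isT).
        rewrite (ger0_norm (ltW t0)) => t2; move: e0 ht t2; set w := Num.min _ _; lra.
      have h1 := lem (x - c); have h2 := lem (d - x).
      rewrite /psi smooth_step_ge1 ?smooth_step_le0 ?subr0//.
        by have := h2; rewrite ge_min lexx orbT => /(_ isT); nra.
      by have := h1; rewrite ge_min lexx => /(_ isT); nra.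
    have -> : (fun n => du x * psi n x) = fun=> 0; last exact: cvg_cst.
    apply/funext => n; have [xc|cx] := leP x c; first by rewrite psi_le// mulr0.
    have [dx|xd] := leP d x; first by rewrite psi_ge// mulr0.
    by move: xcd; rewrite notin_setE /= in_itv /= cx xd.
  - exact: Rintegrable_normr.
  - by move=> n x _; rewrite normrM ler_piMr// psi_bound.
have R2 : \int[mu]_(x in `[a, b]) ((du \_ `]c, d[) x) = \int[mu]_(x in `[c, d]) du x.
  rewrite -Rintegral_mkcondr.
  have -> : `[a, b]%classic `&` `]c, d[ = `]c, d[%classic.
    apply/setIidPr => x /=; rewrite !in_itv /= => /andP[cx xd].
    by rewrite (ltW (lt_trans ac cx)) (ltW (lt_trans xd db)).
  have dui' : Rintegrable `[c, d] du.
    apply: RintegrableS dui => // x /=; rewrite !in_itv /= => /andP[cx xd].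
    by rewrite (le_trans (ltW ac) cx) (le_trans xd (ltW db)).
  rewrite Rintegral_itv_obnd_cbnd; last first.
    by apply: RintegrableS dui' => //; exact: subset_itv_oo_cc.
  rewrite Rintegral_itv_bndo_bndc//.
  by apply: RintegrableS dui' => //; exact: subset_itv_co_cc.
have lim1 : (- \int[mu]_(x in `[a, b]) (du x * psi n x)) @[n --> \oo] --> u c - u d.
  have -> : (fun n => - \int[mu]_(x in `[a, b]) (du x * psi n x)) =
      (fun n => \int[mu]_(x in `[a, b]) (u x * k1 n x) -
        \int[mu]_(x in `[a, b]) (u x * k2 n x)).
    by apply/funext => n; rewrite -(wd _ (tpsi n)) L.
  exact: cvgB.
have lim2 : (- \int[mu]_(x in `[a, b]) (du x * psi n x)) @[n --> \oo] -->
    - \int[mu]_(x in `[a, b]) ((du \_ `]c, d[) x) by exact: cvgN.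
rewrite -R2; apply: oppr_inj; rewrite opprB.
by rewrite -(cvg_lim _ lim1)// -(cvg_lim _ lim2).
Unshelve. all: by end_near. Qed.

End fundamental_theorem.

Section absolutely_continuous.
Context {R : realType}.
Notation mu := (@lebesgue_measure R).

(** Absolute continuity of [u], with derivative [du] almost everywhere. *)
Definition primitive_on (a b : R) (u du : R -> R) : Prop :=
  Rintegrable `[a, b] du /\
  forall c d, a <= c -> c <= d -> d <= b -> u d - u c = \int[mu]_(x in `[c, d]) du x.

Lemma Rintegral_itv_cat (a b c : R) (f : R -> R) : a <= b -> b <= c ->
  Rintegrable `[a, c] f ->
  \int[mu]_(x in `[a, c]) f x =
  \int[mu]_(x in `[a, b]) f x + \int[mu]_(x in `[b, c]) f x.
Proof.
move=> ab bc fi; apply/eqP; rewrite addrC -subr_eq; apply/eqP.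
rewrite Rintegral_itvB//.
apply: Rintegral_itv_obnd_cbnd; apply: RintegrableS fi => //.
by move=> x /=; rewrite !in_itv /= => /andP[bx ->]; rewrite (le_trans ab (ltW bx)).
Qed.

(** Increments of [u] are those of the integral of [du] inside the interval,
    by the preceding lemma. So their difference [W] is constant there, and, being
    continuous, up to the end points. *)
Lemma weak_derivative_primitive (u du : R -> R) (a b : R) : a < b ->
  {within `[a, b], continuous u} -> Rintegrable `[a, b] du ->
  weak_derivative a b u du -> primitive_on a b u du.
Proof.
move=> ab cu dui wd; split => //.
have dui' c d : a <= c -> d <= b -> Rintegrable `[c, d] du.
  move=> ac db; apply: RintegrableS dui => // x /=; rewrite !in_itv /=.
  by move=> /andP[cx xd]; rewrite (le_trans ac cx) (le_trans xd db).
pose I x := \int[mu]_(y in `[a, x]) du y.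
have Ic : {within `[a, b], continuous I}.
  exact: parameterized_integral_continuous (ltW ab) dui.
pose W x := u x - I x.
have Wc : {within `[a, b], continuous W}.
  by move=> x; apply: cvgB; [exact: cu|exact: Ic].
have Woo (x y : R) : a < x -> x <= y -> y < b -> W x = W y.
  move=> ax; rewrite le_eqVlt => /predU1P[->//|xy] yb.
  have H := weak_derivative_increment_oo ax xy yb cu dui wd.
  have HI : I y = I x + \int[mu]_(z in `[x, y]) du z.
    by apply: Rintegral_itv_cat; [exact: ltW|exact: ltW|exact: dui' (lexx a) (ltW yb)].
  by rewrite /W HI -H; ring.
have Wd (x : R) : x \in `]a, b[ -> is_derive x 1 W ((fun=> 0) x).
  move=> xab; apply: (@near_eq_is_derive _ _ _ (cst (W x))).
  have := near_in_itvoo xab; apply: filterS => y; move: xab.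
  rewrite !in_itv /= => /andP[ax xb] /andP[ay yb].
  rewrite /cst; have [xy|/ltW yx] := leP x y; first exact: (Woo _ _ ax xy yb).
  by rewrite (Woo _ _ ay yx xb).
have Wcst x : a <= x -> x <= b -> W x = W a.
  move=> ax xb; apply/eqP; rewrite -subr_eq0.
  have [||c _ ->] := @MVT_segment _ W (fun=> 0) a x ax.
  - move=> y yax; apply: Wd; move: yax; rewrite !in_itv /= => /andP[-> yx].
    exact: lt_le_trans yx xb.
  - apply: continuous_subspaceW Wc => y /=; rewrite !in_itv /= => /andP[-> yx].
    exact: le_trans yx xb.
  - by rewrite mul0r.
move=> c d ac cd db.
have := Wcst d (le_trans ac cd) db; rewrite -(Wcst c ac (le_trans cd db)) /W.
have -> : I d = I c + \int[mu]_(z in `[c, d]) du z.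
  by apply: Rintegral_itv_cat => //; exact: dui'.
by move=> /eqP; rewrite subr_eq => /eqP ->; ring.
Qed.

Lemma primitive_on_H1 (u du : R -> R) (a b : R) : a < b -> H1 a b u du ->
  primitive_on a b u du.
Proof.
move=> ab [cu _ du2 wd]; apply: weak_derivative_primitive => //.
exact: square_integrable_Rintegrable.
Qed.

End absolutely_continuous.

(** * Stieltjes sums, integration by parts and reparametrization *)

Section riemann_stieltjes.
Context {R : realType}.
Notation mu := (@lebesgue_measure R).

(** The compactness of [[a, b]] makes the modulus of continuity uniform: near
    each point of [[a, b]], some radius [d] works for all points and all smaller
    radii. *)
Lemma uniformly_continuous_itv (u : R -> R) (a b e : R) : 0 < e ->
  {within `[a, b], continuous u} ->
  exists2 d : R, 0 < d & forall x y, a <= x <= b -> a <= y <= b ->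
    `|y - x| < d -> `|u y - u x| <= e.
Proof.
move=> e0 /subspace_continuousP cu.
have := segment_compact (a := a) (b := b).
rewrite compact_near_coveringP -near_covering_withinP.
(* the radius [d] runs along the filter of small positive numbers *)
move=> /(_ R (0^'+) (fun d x => forall y, a <= y <= b -> `|y - x| < d ->
   `|u y - u x| <= e) _) [].
  move=> x xab; have e2 : 0 < e / 2 by rewrite divr_gt0.
  have /cvgrPdist_le /(_ _ e2)[r /= r0 ur] := cu x xab.
  have r2 : 0 < r / 2 by rewrite divr_gt0.
  have hw (z : R) : `|z - x| < r -> a <= z <= b -> `|u x - u z| <= e / 2.
    by move=> zr zab; apply: ur; rewrite ?in_itv //= distrC.
  exists ([set z | `|z - x| < r / 2], [set d | d < r / 2]) => /=.
    split; first by exists (r / 2) => //= z /=; rewrite distrC.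
    by apply: nbhs_right_lt.
  move=> [z d] /= [zx dr] zab y yab yz.
  rewrite -(subrK (u x) (u y)) -addrA; apply: (le_trans (ler_normD _ _)).
  rewrite (splitr e) lerD//; last first.
    by apply: hw => //; apply: lt_trans zx _; lra.
  rewrite distrC; apply: hw => //.
  have -> : y - x = (y - z) + (z - x) by ring.
  by apply: (le_lt_trans (ler_normD _ _)); lra.
move=> r /= r0 H; exists (r / 2); first by rewrite divr_gt0.
move=> x y xab yab yx.
have r2 : 0 < r / 2 by rewrite divr_gt0.
apply: (H (r / 2)) => //=.
by rewrite sub0r normrN gtr0_norm//; lra.
Qed.

Definition grid (a b : R) (n i : nat) : R := a + (b - a) * (i%:R / n.+1%:R).

Lemma grid0 (a b : R) (n : nat) : grid a b n 0 = a.
Proof. by rewrite /grid mul0r mulr0 addr0. Qed.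

Lemma grid_last (a b : R) (n : nat) : grid a b n n.+1 = b.
Proof. by rewrite /grid divff ?pnatr_eq0// mulr1 addrC subrK. Qed.

Lemma grid_le (a b : R) (n i : nat) : a <= b -> grid a b n i <= grid a b n i.+1.
Proof.
by move=> ab; rewrite lerD2l ler_wpM2l ?subr_ge0// ler_pM2r ?invr_gt0// ler_nat.
Qed.

(** On each cell of the grid, [u] differs from its value at the tag by at most
    the modulus of continuity of [u]; the error is at most this modulus times the
    integral of [`|dv|]. The tags are arbitrary, since the integration by parts
    uses both ends of the cells. *)
Lemma riemann_stieltjes_sum (a b : R) (u v dv : R -> R) (xi : nat -> nat -> R) :
  a <= b -> {within `[a, b], continuous u} -> primitive_on a b v dv ->
  (forall n i, grid a b n i <= xi n i <= grid a b n i.+1) ->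
  \sum_(i < n.+1) u (xi n i) * (v (grid a b n i.+1) - v (grid a b n i)) @[n --> \oo]
    --> \int[mu]_(x in `[a, b]) (u x * dv x).
Proof.
move=> ab cu [dvi vE] xiP.
pose K := \int[mu]_(x in `[a, b]) `|dv x|.
have K0 : 0 <= K by apply: Rintegral_ge0.
apply/cvgrPdist_le => e e0.
have c0 : 0 < 1 + K by rewrite ltr_wpDr.
have [d d0 Hd] := uniformly_continuous_itv (divr_gt0 e0 c0) cu.
near=> n.
have n0 : 0 < n.+1%:R :> R by [].
have gS i : grid a b n i.+1 - grid a b n i = (b - a) / n.+1%:R.
  by rewrite /grid -natr1; field; rewrite gt_eqF.
have dn : (b - a) / n.+1%:R < d.
  rewrite ltr_pdivrMr// mulrC -ltr_pdivrMr//; apply: (@lt_trans _ _ n%:R).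
    by near: n; exact: nbhs_infty_gtr.
  by rewrite ltr_nat.
have gle i := grid_le n i ab.
have ga i : a <= grid a b n i by rewrite /grid lerDl mulr_ge0 ?subr_ge0 ?divr_ge0.
have gb i : (i <= n.+1)%N -> grid a b n i <= b.
  move=> ni; rewrite -lerBrDl ler_piMr ?subr_ge0//.
  by rewrite ler_pdivrMr// mul1r ler_nat.
have sub (f : R -> R) c c' : a <= c -> c' <= b -> Rintegrable `[a, b] f ->
    Rintegrable `[c, c'] f.
  move=> ac cb fi; apply: RintegrableS fi => // x /=; rewrite !in_itv /=.
  by move=> /andP[cx xd]; rewrite (le_trans ac cx) (le_trans xd cb).
have ui : Rintegrable `[a, b] (fun x => u x * dv x) by exact: RintegrableMl.
have ndi : Rintegrable `[a, b] (fun x => `|dv x|) by exact: Rintegrable_normr.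
have step i : (i < n.+1)%N ->
    `|\int[mu]_(x in `[grid a b n i, grid a b n i.+1]) (u x * dv x) -
      u (xi n i) * (v (grid a b n i.+1) - v (grid a b n i))| <=
    e / (1 + K) * \int[mu]_(x in `[grid a b n i, grid a b n i.+1]) `|dv x|.
  move=> ni; have gib := gb _ ni.
  have dvi' := sub _ _ _ (ga i) gib dvi.
  have ui' := sub _ _ _ (ga i) gib ui.
  have ndi' := sub _ _ _ (ga i) gib ndi.
  rewrite vE// -!RintegralZl_lebesgue//.
  rewrite -RintegralB_lebesgue//; last exact: RintegrableZ.
  apply: ler_norm_Rintegral => //.
  - by apply: RintegrableB => //; exact: RintegrableZ.
  - exact: RintegrableZ.
  - move=> x; rewrite /= in_itv /= => /andP[x1 x2].
    rewrite -mulrBl normrM ler_wpM2r//.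
    have /andP[xi1 xi2] := xiP n i.
    apply: Hd.
    + by rewrite (le_trans (ga i) xi1) (le_trans xi2 gib).
    + by rewrite (le_trans (ga i) x1) (le_trans x2 gib).
    + apply: le_lt_trans dn; rewrite -(gS i) ler_norml; apply/andP; split; lra.
have main k : (k <= n.+1)%N ->
    `|\int[mu]_(x in `[a, grid a b n k]) (u x * dv x) -
      \sum_(i < k) u (xi n i) * (v (grid a b n i.+1) - v (grid a b n i))| <=
    e / (1 + K) * \int[mu]_(x in `[a, grid a b n k]) `|dv x|.
  elim: k => [_|k IH kn].
    by rewrite grid0 big_ord0 subr0 set_itv1 !Rintegral_set1 normr0 mulr0.
  have gkb := gb _ kn.
  rewrite big_ord_recr /=.
  rewrite (@Rintegral_itv_cat _ a (grid a b n k))//; last exact: sub.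
  rewrite [in leRHS](@Rintegral_itv_cat _ a (grid a b n k))//; last exact: sub.
  rewrite opprD addrACA [leRHS]mulrDr; apply: (le_trans (ler_normD _ _)).
  by apply: lerD; [apply: IH; exact: ltnW|exact: step].
have := main n.+1 (leqnn _); rewrite grid_last => H; apply: (le_trans H).
by rewrite -/K mulrAC ler_pdivrMr// ler_wpM2l ?lerDr// ltW.
Unshelve. all: by end_near. Qed.

(** Summation by parts: with the right tags for [u dv] and the left tags for
    [v du], the two Stieltjes sums add up to a telescoping sum. *)
Lemma integration_by_parts_primitive (a b : R) (u du v dv : R -> R) : a <= b ->
  {within `[a, b], continuous u} -> {within `[a, b], continuous v} ->
  primitive_on a b u du -> primitive_on a b v dv ->
  \int[mu]_(x in `[a, b]) (u x * dv x) + \int[mu]_(x in `[a, b]) (v x * du x) =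
  u b * v b - u a * v a.
Proof.
move=> ab cu cv pu pv.
have Lu := @riemann_stieltjes_sum a b u v dv (fun n i => grid a b n i.+1) ab cu pv.
have Lv := @riemann_stieltjes_sum a b v u du (fun n i => grid a b n i) ab cv pu.
have {}Lu : \sum_(i < n.+1) u (grid a b n i.+1) *
      (v (grid a b n i.+1) - v (grid a b n i)) @[n --> \oo] -->
    \int[mu]_(x in `[a, b]) (u x * dv x).
  by apply: Lu => n i; rewrite lexx grid_le.
have {}Lv : \sum_(i < n.+1) v (grid a b n i) *
      (u (grid a b n i.+1) - u (grid a b n i)) @[n --> \oo] -->
    \int[mu]_(x in `[a, b]) (v x * du x).
  by apply: Lv => n i; rewrite lexx grid_le.
have E : forall n,
    \sum_(i < n.+1) u (grid a b n i.+1) * (v (grid a b n i.+1) - v (grid a b n i)) +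
    \sum_(i < n.+1) v (grid a b n i) * (u (grid a b n i.+1) - u (grid a b n i)) =
    u b * v b - u a * v a.
  move=> n; rewrite -big_split /=.
  transitivity (u (grid a b n n.+1) * v (grid a b n n.+1) -
     u (grid a b n 0) * v (grid a b n 0)); last by rewrite grid_last grid0.
  rewrite -(@telescope_sumr _ 0%N n.+1 (fun i => u (grid a b n i) * v (grid a b n i)))//.
  by rewrite big_mkord; apply: eq_bigr => i _; ring.
have L : (fun=> u b * v b - u a * v a) @ \oo -->
    \int[mu]_(x in `[a, b]) (u x * dv x) + \int[mu]_(x in `[a, b]) (v x * du x).
  by rewrite -(funext E); exact: cvgD Lu Lv.
by rewrite -(cvg_lim (@Rhausdorff R) L); apply: lim_cst; exact: Rhausdorff.
Qed.

(** Stieltjes sums do not see the parametrization. *)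
Lemma integral_reparametrization (L : R) (y x dx y0 x0 dx0 : R -> R) : 0 < L ->
  {within `[0, 1], continuous y} -> {within `[0, L], continuous y0} ->
  primitive_on 0 1 x dx -> primitive_on 0 L x0 dx0 ->
  (forall r, 0 <= r <= 1 -> x r = x0 (L * r)) ->
  (forall r, 0 <= r <= 1 -> y r = y0 (L * r)) ->
  \int[mu]_(r in `[0, 1]) (y r * dx r) = \int[mu]_(s in `[0, L]) (y0 s * dx0 s).
Proof.
move=> L0 cy cy0 px px0 xE yE.
have H1 := @riemann_stieltjes_sum 0 1 y x dx (fun n i => grid 0 1 n i) ler01 cy px.
have H2 := @riemann_stieltjes_sum 0 L y0 x0 dx0 (fun n i => grid 0 L n i)
  (ltW L0) cy0 px0.
have {}H1 : \sum_(i < n.+1) y (grid 0 1 n i) *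
      (x (grid 0 1 n i.+1) - x (grid 0 1 n i)) @[n --> \oo] -->
    \int[mu]_(r in `[0, 1]) (y r * dx r).
  by apply: H1 => n i; rewrite lexx grid_le.
have {}H2 : \sum_(i < n.+1) y0 (grid 0 L n i) *
      (x0 (grid 0 L n i.+1) - x0 (grid 0 L n i)) @[n --> \oo] -->
    \int[mu]_(s in `[0, L]) (y0 s * dx0 s).
  by apply: H2 => n i; rewrite lexx grid_le// ltW.
rewrite -(cvg_lim (@Rhausdorff R) H1) -(cvg_lim (@Rhausdorff R) H2).
congr (lim (_ @ \oo)); apply/funext => n; apply: eq_bigr => i _.
have g01 (j : nat) : (j <= n.+1)%N -> 0 <= grid 0 1 n j <= 1.
  move=> jn; rewrite /grid add0r subr0 mul1r divr_ge0//=.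
  by rewrite ler_pdivrMr// mul1r ler_nat.
have gL (j : nat) : grid 0 L n j = L * grid 0 1 n j.
  by rewrite /grid !add0r !subr0 mul1r.
by rewrite !gL -!xE -?yE ?g01// ltnW.
Qed.

End riemann_stieltjes.

(** * The energy density as a function of the tangent vector *)

Section energy_density.
Context {R : realType}.
Variables gamma dgamma : R -> R.
Hypothesis Hgamma : surface_energy gamma dgamma.

(** One period on each side is enough: the angles considered stay within [pi / 2]
    of [[- pi, pi]]. *)
Definition periodic_continuation (f : R -> R) (x : R) : R :=
  if pi < x then f (x - pi *+ 2) else if x < - pi then f (x + pi *+ 2) else f x.

Lemma periodic_continuation_id (f : R -> R) (x : R) : - pi <= x <= pi ->
  periodic_continuation f x = f x.
Proof.
by move=> /andP[x1 x2]; rewrite /periodic_continuation !ltNge x1 x2.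
Qed.

(** At [pi] and at [- pi], the one-sided derivatives at both ends of the period
    are glued together. *)
Lemma is_derive_periodic_continuation (x : R) : - pi <= x <= pi ->
  is_derive x 1 (periodic_continuation gamma) (dgamma x).
Proof.
have [_ dg _ gpi dgpi] := Hgamma.
have pi0 := pi_gt0 R.
move=> xpi; apply/is_deriveP/has_derivative_inP => e e0.
have /has_derivative_inP /(_ _ e0)[d1 d10 H1] := dg x xpi.
have piP : (- pi <= pi :> R) && (pi <= pi :> R) by rewrite lexx andbT; lra.
have NpiP : (- pi <= - pi :> R) && (- pi <= pi :> R) by rewrite lexx; lra.
have /has_derivative_inP /(_ _ e0)[d2 d20 H2] := dg _ piP.
have /has_derivative_inP /(_ _ e0)[d3 d30 H3] := dg _ NpiP.
move/andP: xpi => [x1 x2].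
pose d4 : R := if x == pi then pi else pi - x.
pose d5 : R := if x == - pi then pi else x + pi.
have d40 : 0 < d4.
  by rewrite /d4; case: eqVneq => // xn; rewrite subr_gt0 lt_neqAle xn x2.
have d50 : 0 < d5.
  rewrite /d5; case: eqVneq => // xn; rewrite -[pi]opprK subr_gt0 lt_neqAle x1 andbT.
  by rewrite eq_sym.
(* [d4] and [d5] keep [z] from crossing an end of the period, unless [x] is
   this very end *)
exists (Num.min (Num.min d1 (Num.min d2 d3)) (Num.min d4 d5)).
  by rewrite !lt_min d10 d20 d30 d40 d50.
move=> z _; rewrite !lt_min => /andP[/andP[zd1 /andP[zd2 zd3]] /andP[zd4 zd5]].
have E : periodic_continuation gamma x = gamma x.
  by apply: periodic_continuation_id; rewrite x1 x2.
have [zpi|zpi] := ltP pi z.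
  have xE : x = pi.
    apply/eqP/negPn/negP => xn; move: zd4; rewrite /d4 (negbTE xn) => zd4.
    by move: (ler_norm (z - x)); lra.
  rewrite E /periodic_continuation zpi xE -gpi -dgpi.
  have E2 : z - pi *+ 2 - - pi = z - pi :> R by rewrite mulr2n; lra.
  have := H3 (z - pi *+ 2); rewrite E2 -xE; apply => //.
  rewrite /= in_itv /= mulr2n; move: zd5; rewrite /d5 xE => zd5.
  apply/andP; split; first by lra.
  have := ler_norm (z - pi); move: zd5.
  by case: eqP => ?; lra.
have [zNpi|zNpi] := ltP z (- pi).
  have xE : x = - pi.
    apply/eqP/negPn/negP => xn; move: zd5; rewrite /d5 (negbTE xn) => zd5.
    by move: (ler_norm (- (z - x))); rewrite normrN; lra.
  rewrite E /periodic_continuation ltNge zpi /= zNpi xE gpi dgpi.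
  have E2 : z + pi *+ 2 - pi = z - - pi :> R by rewrite mulr2n; lra.
  have := H2 (z + pi *+ 2); rewrite E2 -xE; apply => //.
  rewrite /= in_itv /= mulr2n; move: zd4; rewrite /d4 xE => zd4.
  apply/andP; split; last by lra.
  have := ler_norm (- (z - - pi)); rewrite normrN; move: zd4.
  by case: eqP => ?; lra.
rewrite E periodic_continuation_id ?zNpi ?zpi//.
by apply: H1 => //; rewrite /= in_itv /= zNpi zpi.
Qed.

(** An angle in [[- pi, pi]] is determined by its cosine and its sine, except
    that [pi] and [- pi] are the same direction. *)
Lemma eq_angle (f : R -> R) (a b : R) : f (- pi) = f pi ->
  - pi <= a <= pi -> - pi <= b <= pi -> cos a = cos b -> sin a = sin b ->
  f a = f b.
Proof.
move=> fpi /andP[a1 a2] /andP[b1 b2] cab sab.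
have nab : `|a| = `|b|.
  apply: cos_inj; rewrite ?cos_norm// in_itv /= normr_ge0 ler_norml.
    by rewrite a1 a2.
  by rewrite b1 b2.
have [->//|] := eqVneq a b; move: nab => /eqP; rewrite eqr_norm2 => /orP[/eqP->|].
  by rewrite eqxx.
move=> /eqP aE ab; move: sab; rewrite aE sinN => sab.
have sb : sin b = 0 by lra.
have [b0|b0|b0] := ltgtP b 0.
- have bpi : b = - pi.
    apply/eqP/negPn/negP => bn.
    have : 0 < sin (- b).
      apply: sin_gt0_pi; rewrite oppr_gt0 b0 /= ltrNl lt_neqAle b1 andbT.
      by rewrite eq_sym.
    by rewrite sinN sb oppr0 ltxx.
  by rewrite bpi opprK fpi.
- have bpi : b = pi.
    apply/eqP/negPn/negP => bn.
    have : 0 < sin b.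
      by apply: sin_gt0_pi; rewrite b0 /= lt_neqAle b2 andbT.
    by rewrite sb ltxx.
  by rewrite bpi fpi.
- by rewrite b0 oppr0.
Qed.

Lemma eq_periodic_continuation (f : R -> R) (a b : R) : f (- pi) = f pi ->
  - (pi *+ 2) <= a <= pi *+ 2 -> - pi <= b <= pi -> cos a = cos b ->
  sin a = sin b -> periodic_continuation f a = f b.
Proof.
rewrite mulr2n => fpi /andP[a1 a2] bpi cab sab; have pi0 := pi_gt0 R.
rewrite /periodic_continuation mulr2n; have [pia|pia] := ltP pi a.
  have cE := cosD2pi (a - (pi + pi)); have sE := sinD2pi (a - (pi + pi)).
  rewrite mulr2n subrK in cE; rewrite mulr2n subrK in sE.
  apply: eq_angle => //; last by rewrite -sE.
    by apply/andP; split; lra.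
  by rewrite -cE.
have [aNpi|Npia] := ltP a (- pi).
  have cE := cosD2pi a; have sE := sinD2pi a.
  rewrite mulr2n in cE; rewrite mulr2n in sE.
  apply: eq_angle => //; rewrite ?cE ?sE//.
  by apply/andP; split; lra.
by apply: eq_angle => //; rewrite pia Npia.
Qed.

(** The gradient of [gamma (theta) |.|] at [(p, q)]. The angle [theta] may jump
    by [2 pi] along the motion, hence it is replaced by [theta t0 + a t], where
    [a] is the angle of [(p, q)] in the frame of direction [theta t0]: there its
    coordinates are [A] and [B], with [A t0 = N t0] and [B t0 = 0], hence
    [a = atan (B / A)] near [t0] and [N = A cos a + B sin a]. These expressions
    are differentiable, and [gamma] takes the same value at [theta] and at
    [theta t0 + a] up to periodic continuation. *)
Lemma energy_density_derivative (p q theta : R -> R) (t0 dp dq : R) :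
  let N t := Num.sqrt (p t ^+ 2 + q t ^+ 2) in
  0 <= t0 -> has_derivative_in `[0, +oo[ p t0 dp ->
  has_derivative_in `[0, +oo[ q t0 dq -> 0 < N t0 ->
  (forall t, 0 <= t -> 0 < N t -> [/\ - pi <= theta t <= pi,
     p t = N t * cos (theta t) & q t = N t * sin (theta t)]) ->
  has_derivative_in `[0, +oo[ (fun t => gamma (theta t) * N t) t0
    ((gamma (theta t0) * cos (theta t0) - dgamma (theta t0) * sin (theta t0)) * dp +
     (gamma (theta t0) * sin (theta t0) + dgamma (theta t0) * cos (theta t0)) * dq).
Proof.
move=> N t00 hp hq N0 hth.
have It0 : `[0, +oo[%classic t0 by rewrite /= in_itv /= t00.
have [thpi p0 q0] := hth t0 t00 N0.
have := cos2Dsin2 (theta t0); move: p0 q0 thpi.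
set th0 := theta t0; set c := cos th0; set s := sin th0 => p0 q0 thpi cs.
pose P := affine_continuation `[0, +oo[ p t0 dp.
pose Q := affine_continuation `[0, +oo[ q t0 dq.
have dP : is_derive t0 1 P dp by exact: is_derive_affine_continuation.
have dQ : is_derive t0 1 Q dq by exact: is_derive_affine_continuation.
have P0 : P t0 = N t0 * c by rewrite /P affine_continuationE.
have Q0 : Q t0 = N t0 * s by rewrite /Q affine_continuationE.
pose A := c *: P + s *: Q.
pose B := c *: Q - s *: P.
have A0 : A t0 = N t0.
  rewrite /A /= !fctE /GRing.scale /= P0 Q0.
  by transitivity (N t0 * (c ^+ 2 + s ^+ 2)); [ring|rewrite cs mulr1].
have B0 : B t0 = 0 by rewrite /B /= !fctE /GRing.scale /= P0 Q0; ring.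
have dA : is_derive t0 1 A (c * dp + s * dq).
  exact: (is_deriveD (is_deriveZ c dP) (is_deriveZ s dQ)).
have dB : is_derive t0 1 B (c * dq - s * dp).
  exact: (is_deriveB (is_deriveZ c dQ) (is_deriveZ s dP)).
have A00 : A t0 != 0 by rewrite A0 gt_eqF.
have dV : is_derive t0 1 (fun t => (A t)^-1) (- (A t0) ^- 2 * (c * dp + s * dq)).
  split; first exact: derivableV.
  by rewrite deriveV//; have [_ ->] := dA.
pose a := fun t => atan (B t * (A t)^-1).
have a0 : a t0 = 0 by rewrite /a B0 mul0r atan0.
have da : is_derive t0 1 a ((c * dq - s * dp) / N t0).
  have dBA : is_derive t0 1 (B * (fun t => (A t)^-1)) ((c * dq - s * dp) / N t0).
    apply: is_derive_eq; rewrite B0 A0 /GRing.scale /= mul0r add0r mulrC //.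
  have dat : is_derive ((B * (fun t => (A t)^-1)) t0) 1 (@atan R) 1.
    apply: is_derive_eq; rewrite /= fctE B0 mul0r expr0n /= addr0 invr1 //.
  by have := is_derive1_comp dat dBA; rewrite mul1r.
have dg : is_derive t0 1 (periodic_continuation gamma \o (cst th0 + a))
    (dgamma th0 * ((c * dq - s * dp) / N t0)).
  apply: is_derive1_comp.
    have -> : (cst th0 + a) t0 = th0 by rewrite fctE a0 addr0.
    exact: is_derive_periodic_continuation.
  by apply: is_derive_eq; rewrite add0r.
have dca : is_derive t0 1 (@cos R \o a) 0.
  have dc : is_derive (a t0) 1 (@cos R) 0.
    by apply: is_derive_eq; rewrite a0 sin0 oppr0.
  by have := is_derive1_comp dc da; rewrite mul0r.
have dsa : is_derive t0 1 (@sin R \o a) ((c * dq - s * dp) / N t0).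
  have dc : is_derive (a t0) 1 (@sin R) 1.
    by apply: is_derive_eq; rewrite a0 cos0.
  by have := is_derive1_comp dc da; rewrite mul1r.
pose M := A * (@cos R \o a) + B * (@sin R \o a).
have dM : is_derive t0 1 M (c * dp + s * dq).
  apply: is_derive_eq (is_deriveD (is_deriveM dA dca) (is_deriveM dB dsa)) _.
  by rewrite A0 B0 /= a0 cos0 sin0 /GRing.scale /=; ring.
have M0 : M t0 = N t0 by rewrite /M /= !fctE /= a0 cos0 sin0 A0 B0; ring.
have dF : is_derive t0 1 ((periodic_continuation gamma \o (cst th0 + a)) * M)
    ((gamma th0 * c - dgamma th0 * s) * dp + (gamma th0 * s + dgamma th0 * c) * dq).
  apply: is_derive_eq (is_deriveM dg dM) _.
  rewrite M0 /= fctE a0 addr0 periodic_continuation_id//.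
  by rewrite /GRing.scale /=; field; rewrite gt_eqF.
apply: (is_derive_has_derivative_in It0 dF).
have cA : {for t0, continuous A}.
  apply/differentiable_continuous/derivable1_diffP.
  by have [] := dA.
have An : \forall t \near t0, 0 < A t.
  by have := cvgr_gt (A t0) cA; apply; rewrite A0.
apply: filterS An => t At; rewrite /= in_itv /= andbT => t_ge0.
have Pt : P t = p t by rewrite /P affine_continuationE//= in_itv /= t_ge0.
have Qt : Q t = q t by rewrite /Q affine_continuationE//= in_itv /= t_ge0.
have AB : A t ^+ 2 + B t ^+ 2 = p t ^+ 2 + q t ^+ 2.
  rewrite /A /B /= !fctE /GRing.scale /= Pt Qt.
  transitivity ((c ^+ 2 + s ^+ 2) * (p t ^+ 2 + q t ^+ 2)); first by ring.
  by rewrite cs mul1r.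
have Nt : 0 < N t.
  rewrite /N -AB sqrtr_gt0; have := sqr_ge0 (B t); nra.
have [tpi pt qt] := hth t t_ge0 Nt.
have Ncos : N t * cos (a t) = A t.
  rewrite /N -AB /a cos_atan.
  have -> : A t ^+ 2 + B t ^+ 2 = A t ^+ 2 * (1 + (B t / A t) ^+ 2).
    by field; rewrite gt_eqF.
  rewrite sqrtrM ?sqr_ge0// sqrtr_sqr gtr0_norm// mulfK//.
  by rewrite sqrtr_eq0 -ltNge ltr_wpDr// sqr_ge0.
have Nsin : N t * sin (a t) = B t.
  have ca : cos (a t) != 0.
    by apply: contra_eq_neq Ncos => ->; rewrite mulr0 lt_eqF.
  have : tan (a t) = B t / A t by rewrite /a atanK.
  rewrite /tan -Ncos => /eqP; rewrite eqr_div//; last by rewrite Ncos gt_eqF.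
  move=> /eqP H; apply: (mulIf ca); rewrite -H; ring.
have Mt : M t = N t.
  rewrite /M /= !fctE /= -Ncos -Nsin.
  transitivity (N t * (cos (a t) ^+ 2 + sin (a t) ^+ 2)); first by ring.
  by rewrite cos2Dsin2 mulr1.
rewrite -Mt; congr (_ * _).
transitivity (periodic_continuation gamma (th0 + a t)); last by [].
have [_ _ _ gpi _] := Hgamma.
have pi0 := pi_gt0 R.
symmetry; apply: eq_periodic_continuation => //.
- have := atan_gtNpi2 (B t * (A t)^-1); have := atan_ltpi2 (B t * (A t)^-1).
  rewrite -/(a t) (mulr2n (pi : R)); move/andP: thpi => [? ?] ? ?; apply/andP; split; lra.
- apply: (mulfI (lt0r_neq0 Nt)); rewrite -pt cosD -/c -/s mulrBr mulrCA Ncos mulrCA Nsin.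
  rewrite /A /B /= !fctE /GRing.scale /= Pt Qt.
  by transitivity ((c ^+ 2 + s ^+ 2) * p t); [ring|rewrite cs mul1r].
- apply: (mulfI (lt0r_neq0 Nt)); rewrite -qt sinD -/c -/s mulrDr mulrCA Ncos mulrCA Nsin.
  rewrite /A /B /= !fctE /GRing.scale /= Pt Qt.
  by transitivity ((c ^+ 2 + s ^+ 2) * q t); [ring|rewrite cs mul1r].
Qed.

End energy_density.

Section energy_density_measurable.
Context {R : realType}.

Lemma surface_energy_continuous (gamma dgamma : R -> R) :
  surface_energy gamma dgamma -> {within `[- pi, pi], continuous gamma}.
Proof.
move=> [_ dg _ _ _].
exact: (@has_derivative_in_continuous _ `[- pi, pi] _ _ dgamma).
Qed.

Lemma tan_half_angle (x : R) : - pi < x < pi ->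
  x = 2 * atan (sin x / (1 + cos x)).
Proof.
move=> /andP[x1 x2].
have -> : sin x / (1 + cos x) = tan (x / 2).
  have c0 : 0 < cos (x / 2) by apply: cos_gt0_pihalf; apply/andP; split; lra.
  have -> : sin x = 2 * (sin (x / 2) * cos (x / 2)).
    by rewrite [in LHS](splitr x) sinD; ring.
  have -> : 1 + cos x = 2 * cos (x / 2) ^+ 2.
    rewrite [in LHS](splitr x) cosD.
    by have := cos2Dsin2 (x / 2); rewrite !expr2 => h; lra.
  by rewrite /tan; field; rewrite gt_eqF.
rewrite tanK; first by field.
by rewrite in_itv /=; apply/andP; split; lra.
Qed.

(** The angle [theta] is an arbitrary choice at the direction [pi], and need not be
    measurable. Elsewhere it is [2 atan (q / (N + p))], a measurable function of
    [p] and [q]; where [N + p = 0], the angle is [pi] or [- pi], and [f] takes the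
    same value at both. *)
Lemma measurable_angle_density (f : R -> R) (D : set R) (p q theta : R -> R) :
  let N t := Num.sqrt (p t ^+ 2 + q t ^+ 2) in
  {within `[- pi, pi], continuous f} -> f (- pi) = f pi ->
  measurable D -> measurable_fun D p -> measurable_fun D q ->
  (forall t, D t -> 0 < N t -> [/\ - pi <= theta t <= pi,
     p t = N t * cos (theta t) & q t = N t * sin (theta t)]) ->
  measurable_fun D (fun t => f (theta t) * N t).
Proof.
move=> N cf fpi mD mp mq hth.
have mN : measurable_fun D N.
  apply: (@measurableT_comp _ _ _ _ _ _ (@Num.sqrt R)) => //.
    by apply: continuous_measurable_fun; exact: sqrt_continuous.
  by apply: measurable_funD; exact: measurable_funX.
have mNp : measurable_fun D (fun t => N t + p t) by exact: measurable_funD.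
(* as [N + p >= 0], the real power is the inverse, in a measurable form *)
pose h t := 2 * atan (q t * (N t + p t) `^ (- 1)).
have mh : measurable_fun D h.
  apply: measurable_funM => //.
  apply: (@measurableT_comp _ _ _ _ _ _ (@atan R)) => //.
    by apply: continuous_measurable_fun => x; exact: continuous_atan.
  apply: measurable_funM => //.
  by apply: (@measurableT_comp _ _ _ _ _ _ (fun x : R => x `^ (- 1))).
have mg : measurable_fun setT (f \_ `[- pi, pi]).
  apply/(measurable_restrictT f) => //.
  exact: subspace_continuous_measurable_fun.
apply: (eq_measurable_fun (fun t =>
  (if N t + p t == 0 then f pi else (f \_ `[- pi, pi]) (h t)) * N t)).
  move=> t /set_mem Dt; have [N0|Npos] := eqVneq (N t) 0; first by rewrite N0 !mulr0.
  have {}Npos : 0 < N t by rewrite lt0r Npos sqrtr_ge0.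
  have [/andP[t1 t2] pE qE] := hth t Dt Npos.
  congr (_ * _); have [Np|Np] := eqVneq (N t + p t) 0.
    have ct : cos (theta t) = -1.
      apply: (mulfI (lt0r_neq0 Npos)); rewrite -pE mulrN1; lra.
    have st : sin (theta t) = 0.
      have := cos2Dsin2 (theta t); rewrite ct sqrrN expr1n => /eqP.
      by rewrite -subr_eq0 addrC addKr sqrf_eq0 => /eqP.
    apply: (@eq_angle _ f) => //; rewrite ?cospi ?sinpi ?ct ?st//.
      by have := pi_gt0 R => pi0; apply/andP; split; lra.
    by rewrite t1 t2.
  have cN : 1 + cos (theta t) != 0.
    by apply: contra_neq Np; rewrite pE => c0; rewrite -{1}(mulr1 (N t)) -mulrDr c0 mulr0.
  have Np0 : 0 <= N t + p t.
    have := cos_geN1 (theta t); rewrite pE => ?; nra.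
  have hE : h t = theta t.
    have thpi : - pi < theta t < pi.
      apply/andP; split.
        rewrite lt_neqAle t1 andbT; apply: contra_neq cN => <-.
        by rewrite cosN cospi subrr.
      by rewrite lt_neqAle t2 andbT; apply: contra_neq cN => ->; rewrite cospi subrr.
    rewrite (tan_half_angle thpi) /h powR_inv1//; congr (2 * atan _).
    move: Np; rewrite pE qE => Np; field; by rewrite cN Np.
  by rewrite hE patchE mem_set//= in_itv /= t1 t2.
apply: measurable_funM => //; apply: measurable_fun_if => //.
  by apply: measurable_fun_eqr.
by apply: measurable_funS (measurableT_comp mg mh) => //; exact: subIsetl.
Qed.

End energy_density_measurable.

(** * Vectors of the plane and geometry of curves *)

Section plane.
Context {R : realType}.
Implicit Types u v : 'cV[R]_2.

Lemma dotE u v : dot u v = u 0 0 * v 0 0 + u 1 0 * v 1 0.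
Proof.
rewrite /dot !big_ord_recl big_ord0 addr0.
by have -> : lift ord0 ord0 = 1 :> 'I_2 by exact: val_inj.
Qed.

Lemma enormE u : enorm u = Num.sqrt (u 0 0 ^+ 2 + u 1 0 ^+ 2).
Proof. by rewrite /enorm dotE !expr2. Qed.

Lemma enorm_ge0 u : 0 <= enorm u. Proof. exact: sqrtr_ge0. Qed.

Lemma vec2E0 (a b : R) : vec2 a b 0 0 = a. Proof. by rewrite mxE. Qed.

Lemma vec2E1 (a b : R) : vec2 a b 1 0 = b. Proof. by rewrite mxE. Qed.

Lemma ler_coord_enorm u (i : 'I_2) : `|u i 0| <= enorm u.
Proof.
rewrite -sqrtr_sqr enormE ler_wsqrtr//.
have [->|->] : i = 0 \/ i = 1.
- by case: i => -[|[|//]] p; [left|right]; exact: val_inj.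
- by rewrite lerDl sqr_ge0.
- by rewrite lerDr sqr_ge0.
Qed.

Lemma enorm_ler_coord u : enorm u <= `|u 0 0| + `|u 1 0|.
Proof.
rewrite enormE -[leRHS]ger0_norm ?addr_ge0// -sqrtr_sqr ler_wsqrtr//.
rewrite sqrrD !real_normK ?num_real// lerD2r lerDl.
by rewrite mulrn_wge0// mulr_ge0.
Qed.

(** Where the vector vanishes, both sides are 0. *)
Lemma enormZ_coord u (i : 'I_2) : enorm u * ((enorm u)^-1 * u i 0) = u i 0.
Proof.
have [u0|un0] := eqVneq (enorm u) 0; last by rewrite mulVKf.
have := ler_coord_enorm u i; rewrite u0 normr_le0 => /eqP ->.
by rewrite !mulr0.
Qed.

Lemma tangent_coord (dX : R -> 'cV[R]_2) r (i : 'I_2) :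
  enorm (dX r) * tangent dX r i 0 = dX r i 0.
Proof. by rewrite /tangent /dsv mxE enormZ_coord. Qed.

Lemma tangent_angle_coord (dX : R -> 'cV[R]_2) (theta : R -> R) r :
  tangent_angle dX theta -> 0 <= r <= 1 -> 0 < enorm (dX r) ->
  [/\ - pi <= theta r <= pi, dX r 0 0 = enorm (dX r) * cos (theta r) &
      dX r 1 0 = enorm (dX r) * sin (theta r)].
Proof.
move=> Hth r01 N0.
have dX0 : dX r != 0.
  apply: contraTneq N0 => ->; rewrite enormE !mxE expr0n /= addr0 sqrtr0.
  by rewrite ltxx.
have [thpi tE] := Hth r r01 dX0; split => //.
  by rewrite -tangent_coord tE vec2E0.
by rewrite -tangent_coord tE vec2E1.
Qed.

Lemma surface_energy_matrixM (gamma dgamma : R -> R) th u :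
  let v := surface_energy_matrix gamma dgamma th *m u in
  v 0 0 = gamma th * u 0 0 - dgamma th * u 1 0 /\
  v 1 0 = dgamma th * u 0 0 + gamma th * u 1 0.
Proof.
have L : lift ord0 ord0 = 1 :> 'I_2 by exact: val_inj.
by split; rewrite !mxE !big_ord_recl big_ord0 !mxE /= addr0 ?L// mulNr.
Qed.

(** The length element cancels the normalisation of the normal vector. *)
Lemma innerv_normal (dX v : R -> 'cV[R]_2) (phi : R -> R) :
  innerv dX v (fun r => phi r *: normal dX r) =
  \int[lebesgue_measure]_(r in `[0, 1])
    (phi r * (v r 1 0 * dX r 0 0 - v r 0 0 * dX r 1 0)).
Proof.
apply: eq_Rintegral => r _; rewrite dotE /normal !mxE /=.
rewrite -[in RHS](tangent_coord dX r 0) -[in RHS](tangent_coord dX r 1).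
rewrite /tangent /dsv !mxE.
by ring.
Qed.

Lemma areaE (X dX : R -> 'cV[R]_2) :
  area X dX = \int[lebesgue_measure]_(r in `[0, 1]) (X r 1 0 * dX r 0 0).
Proof.
by apply: eq_Rintegral => r _; rewrite -mulrA (mulrC (tangent _ _ _ _)) tangent_coord.
Qed.

Lemma H1p_cst : @H1p R (fun=> 1) (fun=> 0).
Proof.
have cc (c : R) : {within `[(0 : R), 1], continuous (fun _ : R => c)}.
  by move=> x; exact: cvg_cst.
have sq (c : R) : square_integrable `[(0 : R), 1] (fun _ : R => c).
  by split => //; exact: continuous_Rintegrable.
split=> //; split => //.
move=> psi [dpsi cpsi [c [d [c0 d1 sup]]]].
under eq_Rintegral do rewrite mul1r.
under [in RHS]eq_Rintegral do rewrite mul0r.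
rewrite Rintegral_cst// mul0r oppr0.
have psi_is (x : R) : is_derive x 1 psi (derive1 psi x).
  by split; [exact: dpsi|rewrite derive1E].
have -> := @Rintegral_is_derive _ psi (derive1 psi) 0 1 ltr01 psi_is cpsi.
have -> : psi 0 = 0.
  by apply/eqP/negPn/negP => /sup /andP[]; rewrite leNgt c0.
have -> : psi 1 = 0.
  by apply/eqP/negPn/negP => /sup /andP[_]; rewrite leNgt d1.
by rewrite subrr.
Qed.

Lemma has_derivative_inM (A : set R) (f g : R -> R) (x df dg : R) : A x ->
  has_derivative_in A f x df -> has_derivative_in A g x dg ->
  has_derivative_in A (fun t => f t * g t) x (df * g x + f x * dg).
Proof.
move=> Ax hf hg.
have dF := is_derive_affine_continuation Ax hf.
have dG := is_derive_affine_continuation Ax hg.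
apply: (@is_derive_has_derivative_in _ _ _ (affine_continuation A f x df *
   affine_continuation A g x dg)) => //.
  apply: is_derive_eq; rewrite !affine_continuationE// /GRing.scale /=; ring.
by exists 1 => //= z _ Az; rewrite fctE !affine_continuationE.
Qed.

End plane.

(** * First variations of the area and of the energy *)

Section evolution.
Context {R : realType}.
Notation mu := (@lebesgue_measure R).
Variables X dX Xt dXt : R -> R -> 'cV[R]_2.
Hypothesis HX : regular_evolution X dX Xt dXt.

Lemma H1p_Rintegrable (u du : R -> R) : H1p u du -> Rintegrable `[0, 1] du.
Proof. by move=> [[_ _ sdu _] _]; exact: square_integrable_Rintegrable. Qed.

Lemma H1p_continuous (u du : R -> R) : H1p u du -> {within `[0, 1], continuous u}.
Proof. by move=> [[]]. Qed.

(** The exceptional sets of the three almost everywhere hypotheses are common to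
    all times up to [T]. Once they are removed, the derivatives and the bounds
    hold everywhere on [B]. *)
Lemma evolution_regular_set (T : R) : 0 <= T ->
  exists (B : set R) (h : R -> R), exists2 c : R, 0 < c &
  [/\ measurable B, B `<=` `[0, 1], Rintegrable `[0, 1] h,
      forall f, Rintegrable `[0, 1] f ->
        \int[mu]_(r in B) f r = \int[mu]_(r in `[0, 1]) f r &
      forall r, B r -> [/\ 0 <= r <= 1,
        forall t, 0 <= t -> forall i : 'I_2,
          has_derivative_in `[0, +oo[ (fun t' => dX r t' i 0) t (dXt r t i 0),
        forall t, 0 <= t <= T -> forall i : 'I_2, `|dXt r t i 0| <= h r &
        forall t, 0 <= t <= T -> c <= enorm (dX r t)]].
Proof.
move=> T0.
have [h hi hae] := evolution_dominated_dXt HX T0.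
have [c c0 cae] := evolution_nondegenerate HX T0.
have [N1 [mN1 N10 S1]] := hae.
have [N2 [mN2 N20 S2]] := cae.
have [N3 [mN3 N30 S3]] := evolution_dt_dX HX.
pose N := N1 `|` N2 `|` N3.
have mN : measurable N by apply: measurableU => //; exact: measurableU.
have N0 : mu N = 0%E.
  by rewrite null_set_setU// ?null_set_setU//; exact: measurableU.
exists (`[0, 1] `\` N), h, c => //; split; [exact: measurableD|exact: subDsetl|by []| |].
- by move=> f fi; exact: Rintegral_setD_negligible.
- move=> r [/=]; rewrite in_itv /= => r01 rN.
  have P1 := contra_notP (@S1 r) (fun h => rN (or_introl (or_introl h))).
  have P2 := contra_notP (@S2 r) (fun h => rN (or_introl (or_intror h))).
  have P3 := contra_notP (@S3 r) (fun h => rN (or_intror h)).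
  split=> //; [exact: P3| |exact: P2].
  by move=> t tT i; apply: (le_trans (ler_coord_enorm _ _)); exact: P1.
Qed.


Lemma Rintegrable_coord (t : R) (i : 'I_2) : 0 <= t ->
  Rintegrable `[0, 1] (fun r => dX r t i 0) /\
  Rintegrable `[0, 1] (fun r => dXt r t i 0).
Proof.
move=> t0; split; first exact: (H1p_Rintegrable (evolution_Xp HX t0 i)).
exact: (H1p_Rintegrable (evolution_dt_Xp HX t0 i)).
Qed.

(** The term [y x_t'] is integrated by parts; the boundary terms cancel as the
    curve and its velocity are periodic. *)
Lemma area_rate (t : R) : 0 <= t ->
  \int[mu]_(r in `[0, 1]) (Xt r t 1 0 * dX r t 0 0 + X r t 1 0 * dXt r t 0 0) =
  innerv (dX^~ t) (Xt^~ t) (fun r => 1 *: normal (dX^~ t) r).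
Proof.
move=> t0.
have [[HX0 pX0] [HX1 pX1]] := (evolution_Xp HX t0 0, evolution_Xp HX t0 1).
have [[HY0 pY0] [HY1 pY1]] := (evolution_dt_Xp HX t0 0, evolution_dt_Xp HX t0 1).
have [cX1 _ _ _] := HX1; have [cY0 _ _ _] := HY0; have [cY1 _ _ _] := HY1.
have [dX0i dY0i] := Rintegrable_coord 0 t0.
have [dX1i dY1i] := Rintegrable_coord 1 t0.
have ibp := integration_by_parts_primitive ler01 cX1 cY0
  (primitive_on_H1 ltr01 HX1) (primitive_on_H1 ltr01 HY0).
rewrite innerv_normal; under [in RHS]eq_Rintegral do rewrite mul1r.
rewrite RintegralD_lebesgue ?RintegralB_lebesgue//; try exact: RintegrableMl.
move: ibp; rewrite pX1 pY0 subrr => /eqP; rewrite addr_eq0 => /eqP ->.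
by [].
Qed.

(** The rate of [y x'] is dominated by [G]: [y_t] is bounded by [M] and [x_t'] by
    [h], so that [x'] and [y] are bounded up to time [T] in terms of their values
    at time 0. *)
Lemma area_increment (t1 T : R) : 0 <= t1 -> t1 < T ->
  exists2 t, t1 < t < T & area (X^~ T) (dX^~ T) - area (X^~ t1) (dX^~ t1) =
    innerv (dX^~ t) (Xt^~ t) (fun r => 1 *: normal (dX^~ t) r) * (T - t1).
Proof.
move=> t10 t1T; have T0 : 0 <= T := le_trans t10 (ltW t1T).
have [B [h [c c0 [mB B01 hi Bint HB]]]] := evolution_regular_set T0.
have [M HM] := evolution_dominated_Xt HX T0.
have [C C0 HC] := continuous_itv_bounded
  (H1p_continuous (evolution_Xp HX (lexx 0) 1)).
pose f t r := X r t 1 0 * dX r t 0 0.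
pose df t r := Xt r t 1 0 * dX r t 0 0 + X r t 1 0 * dXt r t 0 0.
pose G r := M * (`|dX r 0 0 0| + h r * T) + (C + M * T) * h r.
have fi t : 0 <= t -> Rintegrable `[0, 1] (f t).
  move=> t0; apply: RintegrableMl; last exact: (Rintegrable_coord 0 t0).1.
  exact: H1p_continuous (evolution_Xp HX t0 1).
have dfi t : 0 <= t -> Rintegrable `[0, 1] (df t).
  move=> t0; apply: RintegrableD => //; apply: RintegrableMl.
  - exact: H1p_continuous (evolution_dt_Xp HX t0 1).
  - exact: (Rintegrable_coord 0 t0).1.
  - exact: H1p_continuous (evolution_Xp HX t0 1).
  - exact: (Rintegrable_coord 0 t0).2.
have Gi : Rintegrable `[0, 1] G.
  apply: RintegrableD => //; last exact: RintegrableZ.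
  apply: RintegrableZ => //; apply: RintegrableD => //.
    by apply: Rintegrable_normr => //; exact: (Rintegrable_coord 0 (lexx 0)).1.
  rewrite (_ : (fun r => h r * T) = (fun r => T * h r)); last first.
    by apply/funext => r; rewrite mulrC.
  exact: RintegrableZ.
have fdf r : B r -> forall t, 0 <= t <= T ->
    has_derivative_in `[0, +oo[ (f^~ r) t (df t r).
  move=> Br t /andP[t0 _]; have [r01 HdX _ _] := HB r Br.
  apply: has_derivative_inM; first by rewrite /= in_itv /= t0.
    exact: (evolution_dt HX r01 t0).
  exact: HdX.
have dfG r : B r -> forall t, 0 <= t <= T -> `|df t r| <= G r.
  move=> Br t /andP[t0 tT]; have [r01 HdX Hh _] := HB r Br.
  have sub : `[(0 : R), t] `<=` `[0, +oo[.
    by move=> x /=; rewrite !in_itv /= andbT => /andP[].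
  have h0 : 0 <= h r.
    by apply: (@le_trans _ _ `|dXt r 0 0 0|) => //; apply: Hh; rewrite lexx.
  have HX1 (s : R) (i : 'I_2) : 0 <= s <= T -> `|Xt r s i 0| <= M.
    by move=> sT; apply: (le_trans (ler_coord_enorm _ _)); exact: HM.
  have M0 : 0 <= M.
    by apply: (@le_trans _ _ `|Xt r 0 0 0|) => //; apply: HX1; rewrite lexx.
  have b1 : `|dX r t 0 0 - dX r 0 0 0| <= h r * (t - 0).
    apply: (@mean_value_bound _ _ (fun s => dX r s 0 0) (fun s => dXt r s 0 0)
      _ _ _ t0 sub) => x /andP[x0 xt].
      exact: HdX.
    by apply: Hh; rewrite x0 (le_trans xt).
  have b2 : `|X r t 1 0 - X r 0 1 0| <= M * (t - 0).
    apply: (@mean_value_bound _ _ (fun s => X r s 1 0) (fun s => Xt r s 1 0)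
      _ _ _ t0 sub) => x /andP[x0 xt].
      exact: (evolution_dt HX r01 x0).
    by apply: HX1; rewrite x0 (le_trans xt).
  have b3 : `|dX r t 0 0| <= `|dX r 0 0 0| + h r * T.
    rewrite -(subrK (dX r 0 0 0) (dX r t 0 0)) addrC.
    apply: (le_trans (ler_normD _ _)); rewrite lerD2l (le_trans b1)// subr0.
    by rewrite ler_wpM2l.
  have b4 : `|X r t 1 0| <= C + M * T.
    rewrite -(subrK (X r 0 1 0) (X r t 1 0)) addrC.
    apply: (le_trans (ler_normD _ _)); rewrite lerD ?HC// (le_trans b2)// subr0.
    by rewrite ler_wpM2l.
  rewrite /df /G; apply: (le_trans (ler_normD _ _)); rewrite !normrM lerD//.
    by rewrite ler_pM// HX1// t0.
  by rewrite ler_pM// Hh// t0.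
have sB g : Rintegrable `[0, 1] g -> Rintegrable B g by exact: RintegrableS.
have [|t tI E] := @integral_increment _ B T f df G mB _ fdf (sB _ Gi) dfG t1 t10 t1T.
  by move=> t /andP[t0 _]; apply: sB; exact: fi.
exists t => //; rewrite !areaE -(Bint _ (fi _ T0)) -(Bint _ (fi _ t10)) E.
move/andP: tI => [t1t _]; have t0 := le_trans t10 (ltW t1t).
by rewrite Bint ?area_rate//; exact: dfi.
Qed.

End evolution.

Section energy.
Context {R : realType}.
Notation mu := (@lebesgue_measure R).
Variables X dX Xt dXt : R -> R -> 'cV[R]_2.
Hypothesis HX : regular_evolution X dX Xt dXt.
Variables gamma dgamma : R -> R.
Hypothesis Hgamma : surface_energy gamma dgamma.
Variable theta : R -> R -> R.
Hypothesis Htheta : forall t, 0 <= t -> tangent_angle (dX^~ t) (theta^~ t).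

(** The integrand of [(G (theta) d_s X, d_s X_t)] on the curve. *)
Definition energy_rate (t r : R) : R :=
  dot (surface_energy_matrix gamma dgamma (theta r t) *m tangent (dX^~ t) r)
      (dsv (dX^~ t) (dXt^~ t) r) * enorm (dX r t).

Lemma energy_rateE (t r : R) : 0 <= t -> 0 <= r <= 1 -> 0 < enorm (dX r t) ->
  energy_rate t r =
  (gamma (theta r t) * cos (theta r t) - dgamma (theta r t) * sin (theta r t)) *
    dXt r t 0 0 +
  (gamma (theta r t) * sin (theta r t) + dgamma (theta r t) * cos (theta r t)) *
    dXt r t 1 0.
Proof.
move=> t0 r01 N0; have dX0 : dX r t != 0.
  by apply: contraTneq N0 => ->; rewrite enormE !mxE expr0n /= addr0 sqrtr0 ltxx.
have [_ tE] := Htheta t0 r01 dX0.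
rewrite /energy_rate tE dotE.
have /= [-> ->] := surface_energy_matrixM gamma dgamma (theta r t)
  (vec2 (cos (theta r t)) (sin (theta r t))).
rewrite vec2E0 vec2E1 /dsv !mxE; field.
by rewrite gt_eqF.
Qed.

Lemma surface_energy_bounded : exists2 K : R, 0 <= K &
  forall x, - pi <= x <= pi -> `|gamma x| <= K /\ `|dgamma x| <= K.
Proof.
have [_ _ cd _ _] := Hgamma.
have cg := surface_energy_continuous Hgamma.
have [K1 K10 h1] := continuous_itv_bounded cg.
have [K2 K20 h2] := continuous_itv_bounded cd.
exists (K1 + K2) => [|x xpi]; first exact: addr_ge0.
by have := h1 x xpi; have := h2 x xpi; split; lra.
Qed.

Lemma energy_rate_le (K t r : R) :
  (forall x, - pi <= x <= pi -> `|gamma x| <= K /\ `|dgamma x| <= K) ->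
  0 <= t -> 0 <= r <= 1 ->
  `|energy_rate t r| <= 2 * K * (`|dXt r t 0 0| + `|dXt r t 1 0|).
Proof.
move=> HK t0 r01.
have K0 : 0 <= K.
  have pi0 := pi_gt0 R.
  have [] := HK 0 _; first by apply/andP; split; lra.
  by move=> k _; exact: le_trans (normr_ge0 _) k.
have [N0|N0] := eqVneq (enorm (dX r t)) 0.
  by rewrite /energy_rate N0 mulr0 normr0 mulr_ge0 ?addr_ge0// mulr_ge0.
have {}N0 : 0 < enorm (dX r t) by rewrite lt0r N0 enorm_ge0.
rewrite energy_rateE//.
have [thpi _ _] := tangent_angle_coord (Htheta t0) r01 N0.
have [k1 k2] := HK _ thpi.
have c1 : `|cos (theta r t)| <= 1 by rewrite ler_norml cos_geN1 cos_le1.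
have s1 : `|sin (theta r t)| <= 1 by rewrite ler_norml sin_geN1 sin_le1.
have b (x y c s : R) : `|x| <= K -> `|y| <= K -> `|c| <= 1 -> `|s| <= 1 ->
    `|x * c + y * s| <= 2 * K.
  move=> xK yK c1' s1'; apply: (le_trans (ler_normD _ _)).
  rewrite mulr_natl mulr2n !normrM -(mulr1 K); apply: lerD; exact: ler_pM.
apply: (le_trans (ler_normD _ _)); rewrite !normrM mulrDr lerD//.
  by rewrite ler_wpM2r// -mulNr b// normrN.
by rewrite ler_wpM2r// b.
Qed.

(** The measurability of the functions of the angle is known only after
    multiplication by [N = |X'|], which vanishes wherever the angle is
    meaningless. So the cosine and the sine of the angle are written as [x' / N]
    and [y' / N], and the missing powers of [N] are supplied by its inverse. *)
Lemma Rintegrable_energy_rate (t : R) : 0 <= t ->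
  Rintegrable `[0, 1] (energy_rate t).
Proof.
move=> t0; have [K K0 HK] := surface_energy_bounded.
have [_ _ cd gpi dgpi] := Hgamma.
have [dX0i dY0i] := Rintegrable_coord HX 0 t0.
have [dX1i dY1i] := Rintegrable_coord HX 1 t0.
have hth (r : R) : `[0, 1]%classic r ->
  0 < Num.sqrt (dX r t 0 0 ^+ 2 + dX r t 1 0 ^+ 2) ->
  [/\ - pi <= theta r t <= pi,
    dX r t 0 0 = Num.sqrt (dX r t 0 0 ^+ 2 + dX r t 1 0 ^+ 2) * cos (theta r t) &
    dX r t 1 0 = Num.sqrt (dX r t 0 0 ^+ 2 + dX r t 1 0 ^+ 2) * sin (theta r t)].
  rewrite -enormE /= in_itv /=.
  exact: (@tangent_angle_coord _ (dX^~ t) (theta^~ t) r (Htheta t0)).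
have mp := Rintegrable_measurable dX0i; have mq := Rintegrable_measurable dX1i.
have mg := measurable_angle_density (surface_energy_continuous Hgamma) gpi
  (measurable_itv _) mp mq hth.
have md := measurable_angle_density cd dgpi (measurable_itv _) mp mq hth.
pose N (r : R) := Num.sqrt (dX r t 0 0 ^+ 2 + dX r t 1 0 ^+ 2).
have mN : measurable_fun `[(0 : R), 1] (fun r : R => (N r `^ (- 1)) ^+ 2).
  apply: measurable_funX.
  apply: (@measurableT_comp _ _ _ _ _ _ (fun x : R => x `^ (- 1))) => //.
  apply: (@measurableT_comp _ _ _ _ _ _ (@Num.sqrt R)) => //.
    by apply: continuous_measurable_fun; exact: sqrt_continuous.
  by apply: measurable_funD; exact: measurable_funX.
apply: (@le_Rintegrable _ _ _ (fun r => 2 * K * (`|dXt r t 0 0| + `|dXt r t 1 0|))) => //.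
- apply: (eq_measurable_fun (fun r =>
    (gamma (theta r t) * N r * dX r t 0 0 - dgamma (theta r t) * N r * dX r t 1 0) *
       (N r `^ (- 1)) ^+ 2 * dXt r t 0 0 +
    (gamma (theta r t) * N r * dX r t 1 0 + dgamma (theta r t) * N r * dX r t 0 0) *
       (N r `^ (- 1)) ^+ 2 * dXt r t 1 0)).
    move=> r /set_mem rI.
    have [Nr|Nr] := eqVneq (N r) 0.
      by rewrite /energy_rate enormE -/(N r) Nr !mulr0 !mul0r subrr addr0 !mul0r addr0.
    have Nr0 : 0 < N r by rewrite lt0r Nr sqrtr_ge0.
    have [_ pE qE] := hth r rI Nr0.
    rewrite energy_rateE//; last by rewrite enormE.
    rewrite powR_inv1 ?sqrtr_ge0//.
    rewrite -/(N r) in pE qE; rewrite [X in _ * X - _]pE [X in _ - _ * X]qE.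
    rewrite [X in (_ * X + _) * _ * _]qE [X in (_ + _ * X) * _ * dXt r t 1 0]pE.
    by field.
  have mY0 := Rintegrable_measurable dY0i; have mY1 := Rintegrable_measurable dY1i.
  by apply: measurable_funD; apply: measurable_funM => //; apply: measurable_funM => //;
    [apply: measurable_funB|apply: measurable_funD]; apply: measurable_funM.
- by move=> r; rewrite /= in_itv /=; exact: energy_rate_le.
- by apply: RintegrableZ => //; apply: RintegrableD => //; exact: Rintegrable_normr.
Qed.

Lemma Rintegrable_energy (t : R) : 0 <= t ->
  Rintegrable `[0, 1] (fun r => gamma (theta r t) * enorm (dX r t)).
Proof.
move=> t0; have [K K0 HK] := surface_energy_bounded.
have [_ _ _ gpi _] := Hgamma.
have [dX0i _] := Rintegrable_coord HX 0 t0.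
have [dX1i _] := Rintegrable_coord HX 1 t0.
apply: (@le_Rintegrable _ _ _ (fun r => K * (`|dX r t 0 0| + `|dX r t 1 0|))) => //.
- apply: (eq_measurable_fun (fun r => gamma (theta r t) *
    Num.sqrt (dX r t 0 0 ^+ 2 + dX r t 1 0 ^+ 2))).
    by move=> r _; rewrite enormE.
  apply: (measurable_angle_density (surface_energy_continuous Hgamma) gpi) => //.
  + exact: Rintegrable_measurable.
  + exact: Rintegrable_measurable.
  + move=> r; rewrite -enormE /= in_itv /=.
    exact: (@tangent_angle_coord _ (dX^~ t) (theta^~ t) r (Htheta t0)).
- move=> r; rewrite /= in_itv /= => r01.
  have [N0|N0] := eqVneq (enorm (dX r t)) 0.
    by rewrite N0 mulr0 normr0 mulr_ge0// addr_ge0.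
  have {}N0 : 0 < enorm (dX r t) by rewrite lt0r N0 enorm_ge0.
  have [thpi _ _] := tangent_angle_coord (Htheta t0) r01 N0.
  rewrite normrM ler_pM//; first by have [] := HK _ thpi.
  by rewrite (ger0_norm (enorm_ge0 _)) enorm_ler_coord.
- by apply: RintegrableZ => //; apply: RintegrableD => //; exact: Rintegrable_normr.
Qed.

Lemma energy_increment (t1 T : R) : 0 <= t1 -> t1 < T ->
  exists2 t, t1 < t < T &
    energy gamma (dX^~ T) (theta^~ T) - energy gamma (dX^~ t1) (theta^~ t1) =
    innerv (dX^~ t)
      (fun r => surface_energy_matrix gamma dgamma (theta r t) *m tangent (dX^~ t) r)
      (dsv (dX^~ t) (dXt^~ t)) * (T - t1).
Proof.
move=> t10 t1T; have T0 : 0 <= T := le_trans t10 (ltW t1T).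
have [B [h [c c0 [mB B01 hi Bint HB]]]] := evolution_regular_set HX T0.
have [K K0 HK] := surface_energy_bounded.
pose f t r := gamma (theta r t) * enorm (dX r t).
have sB g : Rintegrable `[0, 1] g -> Rintegrable B g by exact: RintegrableS.
have fdf r : B r -> forall t, 0 <= t <= T ->
    has_derivative_in `[0, +oo[ (f^~ r) t (energy_rate t r).
  move=> Br t /andP[t0 tT]; have [r01 HdX _ Hc] := HB r Br.
  have N0 : 0 < enorm (dX r t) by apply: lt_le_trans c0 (Hc t _); rewrite t0.
  rewrite energy_rateE//.
  have -> : f^~ r = fun t => gamma (theta r t) *
      Num.sqrt (dX r t 0 0 ^+ 2 + dX r t 1 0 ^+ 2).
    by apply/funext => s; rewrite /f enormE.
  apply: (energy_density_derivative Hgamma t0 (HdX t t0 0) (HdX t t0 1)).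
    by rewrite -enormE.
  move=> s s0; rewrite -enormE.
  exact: (@tangent_angle_coord _ (dX^~ s) (theta^~ s) r (Htheta s0)).
have Gi : Rintegrable `[0, 1] (fun r => 4 * K * h r) by exact: RintegrableZ.
have dfG r : B r -> forall t, 0 <= t <= T -> `|energy_rate t r| <= 4 * K * h r.
  move=> Br t tT; have [r01 _ Hh _] := HB r Br; have /andP[t0 _] := tT.
  apply: (le_trans (energy_rate_le HK t0 r01)).
  have := Hh t tT 0; have := Hh t tT 1; nra.
have [|t tI E] := @integral_increment _ B T f energy_rate _ mB _ fdf (sB _ Gi)
  dfG t1 t10 t1T.
  by move=> t /andP[t0 _]; apply: sB; exact: Rintegrable_energy.
exists t => //; rewrite /energy /line_integral.
rewrite -(Bint _ (Rintegrable_energy T0)) -(Bint _ (Rintegrable_energy t10)) E.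
move/andP: tI => [t1t _]; have t0 := le_trans t10 (ltW t1t).
by rewrite Bint//; exact: Rintegrable_energy_rate.
Qed.

End energy.

(** * The two rates along a variational solution *)

(** The equation of motion for the test function 1, whose derivative is 0. *)
Lemma area_rate_eq0 (R : realType) (gamma dgamma : R -> R)
    (dX Xt : R -> R -> 'cV[R]_2) (theta mu dmu : R -> R -> R) (t : R) :
  variational_solution gamma dgamma dX Xt theta mu dmu -> 0 <= t ->
  innerv (dX^~ t) (Xt^~ t) (fun r => 1 *: normal (dX^~ t) r) = 0.
Proof.
move=> Hsol t0; have := solution_motion Hsol t0 H1p_cst.
rewrite [X in _ + X](_ : _ = 0) ?addr0//.
rewrite /inner /line_integral.
under eq_Rintegral do rewrite /ds mulr0 mulr0 mul0r.
by rewrite Rintegral_cst// mul0r.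
Qed.

(** The second equation for [omega = X_t], then the first one for [phi = mu],
    turn the rate into [- (d_s mu, d_s mu)]. *)
Lemma energy_rate_le0 (R : realType) (gamma dgamma : R -> R)
    (dX Xt dXt : R -> R -> 'cV[R]_2) (theta mu dmu : R -> R -> R) (t : R) :
  variational_solution gamma dgamma dX Xt theta mu dmu -> 0 <= t ->
  H1pv (Xt^~ t) (dXt^~ t) ->
  innerv (dX^~ t)
    (fun r => surface_energy_matrix gamma dgamma (theta r t) *m tangent (dX^~ t) r)
    (dsv (dX^~ t) (dXt^~ t)) <= 0.
Proof.
move=> Hsol t0 HXt.
have /eqP := solution_potential Hsol t0 HXt.
rewrite subr_eq0 => /eqP <-.
have := solution_motion Hsol t0 (solution_Kp Hsol t0).
move=> /eqP; rewrite addr_eq0 => /eqP motion.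
have -> : inner (dX^~ t) (mu^~ t) (fun r => dot (normal (dX^~ t) r) (Xt r t)) =
    innerv (dX^~ t) (Xt^~ t) (fun r => mu r t *: normal (dX^~ t) r).
  apply: eq_Rintegral => r _; congr (_ * _).
  by rewrite !dotE /normal !mxE /=; ring.
rewrite motion oppr_le0; apply: Rintegral_ge0 => r _.
by rewrite mulr_ge0 ?enorm_ge0// -expr2 sqr_ge0.
Qed.

Theorem proposition2p1 (R : realType) (gamma dgamma : R -> R)
    (X dX Xt dXt : R -> R -> 'cV[R]_2) (theta mu dmu : R -> R -> R)
    (L0 : R) (X0 dX0 : R -> 'cV[R]_2)
    (Hgamma : surface_energy gamma dgamma)
    (HX : regular_evolution X dX Xt dXt)
    (Htheta : forall t, 0 <= t -> tangent_angle (dX^~ t) (theta^~ t))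
    (Hsol : variational_solution gamma dgamma dX Xt theta mu dmu)
    (HX0 : arclength_curve L0 X0 dX0)
    (Hinit : forall r, 0 <= r <= 1 -> X r 0 = X0 (L0 * r)) :
  let A := fun t => area (X^~ t) (dX^~ t) in
  let Wc := fun t => energy gamma (dX^~ t) (theta^~ t) in
  [/\ forall t, 0 <= t -> A t = A 0,
      A 0 = \int[@lebesgue_measure R]_(s in `[0, L0]) (X0 s 1 0 * dX0 s 0 0),
      forall t1 t, 0 <= t1 -> t1 <= t -> Wc t <= Wc t1 /\ Wc t1 <= Wc 0 &
      Wc 0 = line_integral (dX^~ 0) (fun r => gamma (theta r 0))].
Proof.
move=> A Wc.
have W_le (t1 t : R) : 0 <= t1 -> t1 <= t -> Wc t <= Wc t1.
  move=> t10; rewrite le_eqVlt => /predU1P[->//|t1t].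
  have [s /andP[t1s _] E] := energy_increment HX Hgamma Htheta t10 t1t.
  have s0 := le_trans t10 (ltW t1s).
  rewrite -subr_le0 E; apply: mulr_le0_ge0; last by rewrite subr_ge0 ltW.
  exact (energy_rate_le0 Hsol s0 (evolution_dt_Xp HX s0)).
split=> //.
- move=> t; rewrite le_eqVlt => /predU1P[<-//|t0].
  have [s /andP[s0 _] E] := area_increment HX (lexx 0) t0.
  apply/eqP; rewrite -subr_eq0; apply/eqP; rewrite E.
  by rewrite (area_rate_eq0 Hsol (ltW s0)) mul0r.
- have [L00 HX0H _] := HX0.
  have [HXx _] := evolution_Xp HX (lexx 0) 0.
  have [[cXy _ _ _] _] := evolution_Xp HX (lexx 0) 1.
  have [cX0y _ _ _] := HX0H 1.
  rewrite /A areaE.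
  apply: (integral_reparametrization L00 cXy cX0y (primitive_on_H1 ltr01 HXx)
    (primitive_on_H1 L00 (HX0H 0))) => r r01; by rewrite Hinit.
- by move=> t1 t t10 t1t; split; apply: W_le.
Qed.
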